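(* Every anti-involution of $\Lambda$ is $\Gamma$-conjugate to exactly one of $\pm\xi_0,\pm\xi_1,\dots,\pm\xi_4$. Two anti-involutions of $\Lambda$ are $\Gamma$-conjugate if and only if the restrictions of $q$ to their two fixed spaces in $V$ have the same dimension and determinant (equivalently, if and only if the restrictions of $q$ to their two $(-1)$-eigenspaces in $V$ have the same dimension and determinant).
   Context: Let $\omega=e^{2\pi i/3}$, $\mathcal{E}=\mathbb{Z}[\omega]$ the Eisenstein integers, and $\theta=\omega-\bar\omega=\sqrt{-3}$. Let $\Lambda=\mathcal{E}^5$ with Hermitian form $h(x,y)=-x_0\bar y_0+x_1\bar y_1+\dots+x_4\bar y_4$, and let $\Gamma=\mathrm{Aut}(\Lambda)$ be the group of $\mathcal{E}$-linear isometries of $\Lambda$. An anti-involution of $\Lambda$ is an additive bijection $\xi:\Lambda\to\Lambda$ with $\xi(ax)=\bar a\,\xi(x)$ for $a\in\mathcal{E}$, $\xi^2=\mathrm{id}$, and $h(\xi x,\xi y)=\overline{h(x,y)}$. For $j=0,\dots,4$ let $\xi_j$ be the anti-involution $(x_0,\dots,x_4)\mapsto(\bar x_0,\dots,\bar x_{4-j},-\bar x_{5-j},\dots,-\bar x_4)$, i.e. conjugate all coordinates and negate the last $j$ of them. Let $V=\Lambda/\theta\Lambda$, a $5$-dimensional vector space over $\mathbb{F}_3=\mathcal{E}/\theta\mathcal{E}$, with the quadratic form $q$ obtained by reducing $h$ modulo $\theta$. Each anti-involution induces an $\mathbb{F}_3$-linear involution of $V$; its fixed space and its $(-1)$-eigenspace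 carry the restriction of $q$, whose determinant lies in $\mathbb{F}_3^*/(\mathbb{F}_3^* )^2=\{\pm1\}$ (the zero space having determinant $+1$). *)

(* Defs.v *)
From HB Require Import structures.
From mathcomp Require Import all_boot all_order all_algebra.
Set Implicit Arguments. Unset Strict Implicit. Unset Printing Implicit Defensive.
Import Order.TTheory GRing.Theory Num.Theory.
Local Open Scope ring_scope.

(** Eisenstein integers E = Z[w], w = exp(2 pi i/3).
    The pair (a, b) : int * int represents a + b w.  Using w^2 = -1 - w. *)
Definition eis := (int * int)%type.

Definition ezero : eis := (0, 0).
Definition eadd (x y : eis) : eis := (x.1 + y.1, x.2 + y.2).
Definition eopp (x : eis) : eis := (- x.1, - x.2).
Definition emul (x y : eis) : eis :=
  (x.1 * y.1 - x.2 * y.2, x.1 * y.2 + x.2 * y.1 - x.2 * y.2).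
(* complex conjugation: conj(a + b w) = a + b wbar = (a - b) - b w *)
Definition econj (x : eis) : eis := (x.1 - x.2, - x.2).

Definition lat := {ffun 'I_5 -> eis}.
Definition ladd (x y : lat) : lat := [ffun i => eadd (x i) (y i)].
Definition lscale (a : eis) (x : lat) : lat := [ffun i => emul a (x i)].

Definition hsign (i : 'I_5) (z : eis) : eis := if i == ord0 then eopp z else z.
Definition herm (x y : lat) : eis :=
  \big[eadd/ezero]_(i < 5) hsign i (emul (x i) (econj (y i))).

Definition anti_involution (xi : lat -> lat) : Prop :=
  [/\ (forall x y, xi (ladd x y) = ladd (xi x) (xi y)),
      bijective xi,
      (forall a x, xi (lscale a x) = lscale (econj a) (xi x)),
      (forall x, xi (xi x) = x) &
      (forall x y, herm (xi x) (xi y) = econj (herm x y))].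

Definition in_Gamma (g : lat -> lat) : Prop :=
  [/\ (forall x y, g (ladd x y) = ladd (g x) (g y)),
      (forall a x, g (lscale a x) = lscale a (g x)),
      bijective g &
      (forall x y, herm (g x) (g y) = herm x y)].

Definition Gamma_conj (xi xi' : lat -> lat) : Prop :=
  exists g, in_Gamma g /\ forall x, g (xi x) = xi' (g x).

Definition std_xi (k : bool * 'I_5) (x : lat) : lat :=
  [ffun i : 'I_5 =>
     let c := econj (x i) in
     let c' := if (i < 5 - k.2)%N then c else eopp c in
     if k.1 then eopp c' else c'].

(** V = Lambda / theta Lambda = F_3^5 : since w = 1 mod theta,
    a + b w reduces to a + b in F_3 = E/theta E. *)
Definition Vsp := 'rV['F_3]_5.
Definition red (z : eis) : 'F_3 := (z.1 + z.2)%:~R.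
Definition redV (x : lat) : Vsp := \row_i red (x i).
Definition liftV (v : Vsp) : lat := [ffun i => ((nat_of_ord (v ord0 i))%:Z, 0%Z)].

Definition inducedV (xi : lat -> lat) (v : Vsp) : Vsp := redV (xi (liftV v)).
Definition induced_mx (xi : lat -> lat) : 'M['F_3]_5 :=
  \matrix_(i < 5) inducedV xi (delta_mx 0 i).

Definition fixV (xi : lat -> lat) : 'M['F_3]_5 := kermx (induced_mx xi - 1%:M).
Definition negV (xi : lat -> lat) : 'M['F_3]_5 := kermx (induced_mx xi + 1%:M).

(** Gram matrix of q = h mod theta : q(v) = -v_0^2 + v_1^2 + ... + v_4^2. *)
Definition qgram : 'M['F_3]_5 :=
  \matrix_(i < 5, j < 5) (if i == j then (if i == ord0 then -1 else 1) else 0).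

(** Determinant of q restricted to the row space of W, computed in the basis
    row_base W.  Since the nonzero squares of F_3 are {1}, this element of F_3
    is independent of the chosen basis; for the zero space it is 1. *)
Definition qdet_restr (W : 'M['F_3]_5) : 'F_3 :=
  \det (row_base W *m qgram *m (row_base W)^T).

(* Main.v *)
(** The vectors fixed by an anti-involution xi form a Z-lattice L of rank 5 with
    theta Lambda contained in E L, so its Gram matrix G is integral of signature
    (4,1) and admits an integral N with G N = 3.  Every such G is diagonalizable
    over Z with entries +-1, +-3.  Indeed, a primitive isotropic vector lies in a
    hyperbolic pair of G or of N, and then vectors of norm 1 and -1 split off;
    if G is anisotropic, then one of G and N has |det| <= 9, and an LLL-reduced
    basis of it yields a vector of norm +-1.  Splitting it off leaves a form of
    smaller rank, treated in the same way.
    A diagonalizing basis vector of norm +-3 is theta times a vector of Lambda,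
    which xi negates; after this division Lambda has an orthonormal frame of
    eigenvectors of xi with eigenvalues +-1, that is, xi is conjugate to some
    +-xi_j.
    Reduction modulo theta turns a conjugation into an isometry between the
    eigenspaces in V.  For xi_j the fixed space and the (-1)-eigenspace have
    (dimension, determinant) = (5 - j, -1) and (j, 1), and for -xi_j these are
    exchanged, so either pair tells the ten classes apart. *)
From HB Require Import structures.
Require Import Defs.
From mathcomp Require Import all_boot all_order all_algebra all_fingroup.
From mathcomp Require Import ring lra zify.
From Stdlib Require Import Classical.
Set Implicit Arguments. Unset Strict Implicit. Unset Printing Implicit Defensive.
Import Order.TTheory GRing.Theory Num.Theory.
Local Open Scope ring_scope.

(** The main obstacle is indefiniteness, so reduction theory is run with absolute values. In a
    reduced basis the Gram-Schmidt norms satisfy |r_(i+1)| >= 3/4 |r_i|, and their product is the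
    determinant, whence |r_0|^n (3/4)^(n(n-1)/2) <= |det|. Anisotropy keeps the pivots nonzero;
    integrality provides minimal vectors. Since det G det N = 3^n, the smaller determinant is at
    most 3 in absolute value in rank 3 and at most 9 in rank 5. In rank 3 this gives |r_0| < 2 at
    once; for determinant at most 9 in ranks 4 and 5 it gives only |r_0| < 3, and minimal norm 2 has
    to be excluded by a finer analysis that ends with the parity of the determinant. A second
    obstacle: the complement of a vector of norm -1 is positive definite, and a definite form such
    as A_2 is not diagonalizable. Such a complement is therefore kept together with the summand -1,
    because vectors of norm 2 and -1 that are orthogonal add up to one of norm 1. The signature
    enters through the sign of the determinant and a reverse Cauchy-Schwarz inequality, which passes
    to orthogonal summands and to N. *)

Lemma nat_min (P : nat -> Prop) :
  (exists n, P n) -> exists2 n, P n & forall m, P m -> (n <= m)%N.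
Proof.
case=> n; elim/ltn_ind: n => n IHn Pn.
case: (classic (exists2 m, P m & (m < n)%N)) => [[m Pm /IHn]|noP]; first exact.
by exists n => // m Pm; rewrite leqNgt; apply/negP => lt_mn; apply: noP; exists m.
Qed.

(** * Minimal vectors and reduced bases of anisotropic forms *)

Lemma common_denominator m n (S : 'M[rat]_(m, n)) :
  exists2 N : int, 0 < N & exists T : 'M[int]_(m, n), N%:~R *: S = map_mx intr T.
Proof.
exists (\prod_(k : 'I_m * 'I_n) denq (S k.1 k.2)).
  by apply: prodr_gt0 => k _; apply: denq_gt0.
exists (\matrix_(i, j) ((\prod_(k | k != (i, j)) denq (S k.1 k.2)) * numq (S i j))).
apply/matrixP => i j; rewrite !mxE (bigD1 (i, j)) //= mulrC rmorphM rmorphM /= mulrA.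
rewrite -[X in X * _ * _ = _]divq_num_den divfK ?intr_eq0 ?denq_neq0 //.
by rewrite mulrC.
Qed.

(** Smith normal form of a single row: [d] is the content of [x] up to sign, and the other rows of
    [U] complete a primitive vector to a basis. *)
Lemma row_complete n (x : 'rV[int]_n.+1) :
  exists d : int, exists2 U, U \in unitmx & x = d *: row 0 U.
Proof.
have [L _ [R Ru [d _ ->]]] := int_Smith_normal_form x.
exists (L 0 0 * d`_0); exists R => //.
apply/rowP => j; rewrite !mxE (bigD1 0) //= big1 ?addr0 => [|i i0].
  by rewrite !mxE big_ord1 !mxE eqxx mulr1n.
rewrite mxE big_ord1 mxE (_ : (_ == _ :> nat) = false) ?mulr0n ?mulr0 ?mul0r //.
by rewrite eq_sym; apply: negPf i0.
Qed.

(** Gram matrix of the later basis vectors, projected orthogonally to the first. Indexing by all of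
    [nat] lets the rank drop without casts between ordinals. *)
Definition schur (s : nat -> nat -> rat) (i j : nat) : rat :=
  s i.+1 j.+1 - s i.+1 0%N * s 0%N j.+1 / s 0%N 0%N.

(* [fred n s]: the leading n x n block of s is LLL-reduced with respect to the
   absolute values of its (possibly negative) Gram-Schmidt norms. *)
Fixpoint fred (n : nat) (s : nat -> nat -> rat) : Prop :=
  if n is m.+1 then
    [/\ s 0%N 0%N != 0,
        forall j, (j < m)%N -> `|s 0%N j.+1| *+ 2 <= `|s 0%N 0%N|,
        forall j, (j < n)%N -> `|s 0%N 0%N| <= `|s j j| &
        fred m (schur s)]
  else True.

Definition qf (R : comNzRingType) n (S : 'M[R]_n) (x y : 'rV[R]_n) : R :=
  (x *m S *m y^T) 0 0.

Notation "x %:rat" := (map_mx (intr : int -> rat) x) (at level 2, format "x %:rat").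

Lemma qf_congr (R : comNzRingType) n (S U : 'M[R]_n) x y :
  qf (U *m S *m U^T) x y = qf S (x *m U) (y *m U).
Proof. by rewrite /qf trmx_mul !mulmxA. Qed.

Lemma qf_scale (R : comNzRingType) n (S : 'M[R]_n) a x b y :
  qf S (a *: x) (b *: y) = a * b * qf S x y.
Proof. by rewrite /qf linearZ /= -!scalemxAl -scalemxAr !mxE mulrA. Qed.

Lemma qf_row (R : comNzRingType) n (S : 'M[R]_n) (U : 'M_n) i j :
  (U *m S *m U^T) i j = qf S (row i U) (row j U).
Proof.
by rewrite /qf -row_mul mxE [RHS]mxE; apply: eq_bigr => k _; rewrite !mxE.
Qed.

Definition aniso n (S : 'M[rat]_n) :=
  forall x : 'rV[int]_n, x != 0 -> qf S x%:rat x%:rat != 0.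

(** With [N] a common denominator of [S], the values on integral vectors lie in (1/N)Z, so a least
    absolute value exists even for an indefinite form. *)
Lemma min_vector n (S : 'M[rat]_n.+1) :
  exists2 x : 'rV[int]_n.+1, x != 0 & forall y : 'rV[int]_n.+1, y != 0 ->
    `|qf S x%:rat x%:rat| <= `|qf S y%:rat y%:rat|.
Proof.
have [N N_gt0 [T defT]] := common_denominator S.
have qE (y : 'rV[int]_n.+1) : N%:~R * qf S y%:rat y%:rat = (qf T y y)%:~R.
  transitivity (qf T%:rat y%:rat y%:rat); last first.
    by rewrite /qf map_trmx -!map_mxM mxE.
  by rewrite -defT /qf -scalemxAr -scalemxAl [RHS]mxE.
have [|k [x x0 defk] kmin] := nat_min
    (P := fun k => exists2 x : 'rV[int]_n.+1, x != 0 & absz (qf T x x) = k).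
  exists (absz (qf T (delta_mx 0 0) (delta_mx 0 0))), (delta_mx 0 0) => //.
  by apply/eqP => /matrixP /(_ 0 0) /eqP; rewrite !mxE.
exists x => // y y0; have N0 : (0 < N%:~R :> rat) by rewrite ltr0z.
rewrite -(ler_pM2l N0) -{1 2}(gtr0_norm N0) -!normrM !qE -!intr_norm ler_int.
by rewrite -!abszE lez_nat defk kmin //; exists y.
Qed.

Lemma round_near (y : rat) : exists t : int, `|y + t%:~R| *+ 2 <= 1.
Proof.
exists (- Num.floor (y + 1 / 2%:R)).
have /andP[] := floor_itv (y + 1 / 2%:R).
set t := Num.floor _; rewrite intrD rmorphN /= => lb ub.
rewrite -mulr_natr -ler_pdivlMr // ler_norml; apply/andP; split; lra.
Qed.

(** Dividing a minimal vector by its content cannot increase the absolute value, so the minimum is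
    attained at a primitive vector, which can start a basis. *)
Lemma min_basis n (S : 'M[rat]_n.+1) : aniso S ->
  exists2 U : 'M[int]_n.+1, U \in unitmx &
    forall y : 'rV[int]_n.+1, y != 0 ->
      `|(U%:rat *m S *m (U%:rat)^T) 0 0| <= `|qf S y%:rat y%:rat|.
Proof.
move=> anisoS; have [x x0 xmin] := min_vector S.
have [d [U Uu defx]] := row_complete x; exists U => // y y0.
apply: le_trans (xmin y y0); rewrite qf_row -map_row defx map_mxZ qf_scale normrM.
have d0 : d != 0 by apply: contraNneq x0 => d0; rewrite defx d0 scale0r.
rewrite ler_peMl // -rmorphM /= -intr_norm ler1z.
lia.
Qed.

Lemma ratmx_eq0 m n (A : 'M[int]_(m, n)) : (A%:rat == 0) = (A == 0).
Proof.
apply/eqP/eqP => [/matrixP A0|->]; last by rewrite map_mx0.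
by apply/matrixP => i j; have /eqP := A0 i j; rewrite !mxE intr_eq0 => /eqP.
Qed.

Lemma row_unit_neq0 (R : comUnitRingType) n (U : 'M[R]_n) i :
  U \in unitmx -> row i U != 0.
Proof.
move=> Uu; apply/negP => /eqP r0; have /matrixP/(_ 0 i)/eqP := mulmxK Uu (delta_mx 0 i : 'rV_n).
by rewrite -rowE r0 mul0mx !mxE !eqxx eq_sym oner_eq0.
Qed.

Lemma mulmx_unit_neq0 (R : comUnitRingType) n (U : 'M[R]_n) (x : 'rV_n) :
  U \in unitmx -> x != 0 -> x *m U != 0.
Proof. by move=> Uu; apply: contraNneq => xU0; rewrite -(mulmxK Uu x) xU0 mul0mx. Qed.

Lemma aniso_congr n (S : 'M[rat]_n) (U : 'M[int]_n) :
  U \in unitmx -> aniso S -> aniso (U%:rat *m S *m (U%:rat)^T).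
Proof.
by move=> Uu aS x x0; rewrite qf_congr -map_mxM aS // mulmx_unit_neq0.
Qed.

Lemma aniso_rat n (S : 'M[rat]_n) (z : 'rV[rat]_n) :
  aniso S -> z != 0 -> qf S z z != 0.
Proof.
move=> aS z0; have [N N0 [T defT]] := common_denominator z.
have T0 : T != 0.
  apply: contraNneq z0 => T0; move/eqP: defT; rewrite T0 map_mx0 scaler_eq0.
  by rewrite intr_eq0 (gt_eqF N0).
by have := aS _ T0; rewrite -defT qf_scale mulf_eq0 negb_or => /andP[].
Qed.

(** Completing the square; what remains is the Schur complement. *)
Lemma qf_block (a : rat) n (c : 'rV[rat]_n) H (t : 'M_1) (x : 'rV_n) : a != 0 ->
  qf (block_mx a%:M c c^T H) (row_mx t x) (row_mx t x)
  = a * (t 0 0 + (x *m c^T) 0 0 / a) ^+ 2 + qf (H - a^-1 *: (c^T *m c)) x x.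
Proof.
move=> a0; rewrite /qf mul_row_block tr_row_mx mul_row_col mulmxBr mulmxBl.
have -> : t = (t 0 0)%:M by apply: mx11_scalar.
rewrite !mulmxDl -scalemxAr -scalemxAl !mulmxA.
have xc : x *m c^T = ((x *m c^T) 0 0)%:M by apply: mx11_scalar.
have cx : c *m x^T = ((x *m c^T) 0 0)%:M.
  by rewrite -[LHS]trmxK trmx_mul trmxK [in LHS]xc tr_scalar_mx.
rewrite -!(mulmxA _ c) cx xc tr_scalar_mx -!scalar_mxM !mxE !mulr1n.
by field.
Qed.

(** The construction of Hermite, Korkine and Zolotarev: a minimal vector comes first, the Schur
    complement is reduced by induction, and the lifts are corrected by multiples of the first
    vector. Minimality alone bounds the other diagonal entries from below. The last clause asks for
    [i = 0%N] in [nat] so that it also makes sense in rank 0. *)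
Lemma reduced_basis n (S : 'M[rat]_n) : S^T = S -> aniso S ->
  exists2 U : 'M[int]_n, U \in unitmx &
    let S' := U%:rat *m S *m (U%:rat)^T in
    (forall s : nat -> nat -> rat, (forall i j : 'I_n, s i j = S' i j) -> fred n s) /\
    (forall (y : 'rV[int]_n) (i : 'I_n), y != 0 -> i = 0%N :> nat ->
       `|S' i i| <= `|qf S y%:rat y%:rat|).
Proof.
elim: n => [|n IHn] in S *; first by exists 1%:M; [apply: unitmx1 | split => // y []].
move=> symS aS; have [U1 U1u U1min] := min_basis aS.
have [S1 S1E] : exists S1 : 'M[rat]_(1 + n), S1 = U1%:rat *m S *m (U1%:rat)^T by eexists.
rewrite -S1E in U1min.
have aS1 : aniso S1 by rewrite S1E; apply: aniso_congr.
have symS1 : S1^T = S1 by rewrite S1E !trmx_mul trmxK symS mulmxA.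
set a := S1 0 0.
have defS1 : S1 = block_mx a%:M (ursubmx S1 : 'M_(1, n)) (ursubmx S1)^T (drsubmx S1).
  rewrite -[LHS]submxK trmx_ursub symS1; congr block_mx.
  rewrite [LHS]mx11_scalar !mxE /a (_ : lshift n 0 = 0) //; exact/val_inj.
set c := ursubmx S1 in defS1; set H := drsubmx S1 in defS1.
have symH : H^T = H by rewrite /H trmx_drsub symS1.
have a0 : a != 0.
  have := @aS1 (delta_mx 0 0); rewrite /qf map_delta_mx -rowE.
  rewrite trmx_delta -colE !mxE; apply.
  by apply/eqP => /matrixP /(_ 0 0) /eqP; rewrite !mxE.
pose T := H - a^-1 *: (c^T *m c).
have symT : T^T = T by rewrite linearB linearZ /= trmx_mul trmxK symH.
have aT : aniso T.
  (* This [t] makes the completed square vanish, so the Schur complement at [x] is a value of [S1]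
     at a nonzero rational vector. *)
  move=> x x0; pose t : 'M[rat]_1 := (- (x%:rat *m c^T) 0 0 / a)%:M.
  have : row_mx t x%:rat != 0.
    apply: contraNneq x0 => /eqP; rewrite row_mx_eq0 => /andP[_].
    by rewrite ratmx_eq0.
  move/(aniso_rat aS1); rewrite defS1 qf_block // /t mxE mulr1n mulNr addNr.
  by rewrite expr0n mulr0 add0r.
have [U' U'u [U'red _]] := IHn T symT aT.
have /fin_all_exists[t tP] : forall i, exists t : int,
  `|(U'%:rat *m c^T) i 0 / a + t%:~R| *+ 2 <= 1 by move=> i; apply: round_near.
pose tc : 'cV[int]_n := \col_i t i.
(* Adding multiples [tc] of the first vector size-reduces the products with it and leaves the Schur
   complement, already reduced by [U'], unchanged. *)
pose U2 : 'M[int]_(1 + n) := block_mx 1%:M 0 tc U'.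
have U2u : U2 \in unitmx by rewrite unitmxE det_lblock det1 mul1r -unitmxE.
pose U : 'M[int]_n.+1 := U2 *m U1.
have Uu : U \in unitmx by rewrite unitmx_mul U2u.
exists U => //.
have defS' : U%:rat *m S *m (U%:rat)^T = U2%:rat *m S1 *m (U2%:rat)^T.
  by rewrite map_mxM trmx_mul S1E !mulmxA.
pose S' : 'M[rat]_(1 + n) := block_mx
    a%:M (a *: tc%:rat^T + c *m U'%:rat^T) (a *: tc%:rat + U'%:rat *m c^T)
    (U'%:rat *m T *m U'%:rat^T + a^-1 *:
      ((a *: tc%:rat + U'%:rat *m c^T) *m (a *: tc%:rat^T + c *m U'%:rat^T))).
have S'E (i j : 'I_(1 + n)) : (U%:rat *m S *m (U%:rat)^T) i j = S' i j.
  congr (fun_of_matrix _ i j); rewrite /S'.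
  rewrite defS' defS1 [U2%:rat]map_block_mx map_mx1 map_mx0 tr_block_mx trmx1 trmx0.
  rewrite !mulmx_block !mul1mx !mul0mx !mulmx1 !mulmx0 !addr0.
  rewrite !mul_scalar_mx mul_mx_scalar; set W := a *: tc%:rat + _.
  rewrite [RHS](_ : _ = block_mx a%:M (a *: tc%:rat^T + c *m U'%:rat^T) W
    (W *m tc%:rat^T + (tc%:rat *m c + U'%:rat *m H) *m U'%:rat^T)) //.
  congr block_mx; rewrite [W *m (_ + _)]mulmxDr -scalemxAr scalerDr scalerA mulVf // scale1r.
  rewrite addrCA; congr (_ + _).
  rewrite mulmxBr mulmxBl !mulmxDl -!scalemxAr -!scalemxAl scalerDr scalerA mulVf // scale1r.
  by rewrite !mulmxA [LHS]addrC -[LHS]addrA [in LHS](addrC _ (_ - _)) subrK.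
pose i0 : 'I_n.+1 := @lshift 1 n 0; pose r (j : 'I_n) : 'I_n.+1 := @rshift 1 n j.
split=> [s sE|y i y0 vi0]; last first.
  have -> : i = i0 by apply: val_inj; rewrite /= vi0.
  by rewrite !S'E /S' /i0 block_mxEul mxE mulr1n U1min.
have s00 : s 0%N 0%N = a by rewrite (sE i0 i0) !S'E /S' /i0 block_mxEul mxE mulr1n.
have s0j (j : 'I_n) : s 0%N j.+1 = a * ((U'%:rat *m c^T) j 0 / a + (t j)%:~R).
  rewrite (sE i0 (r j)) !S'E /S' /i0 /r block_mxEur mxE addrC mulrDr mulrCA divff // mulr1.
  congr (_ + _); last by rewrite !mxE.
  by rewrite -[U'%:rat *m _]trmxK trmx_mul trmxK [RHS]mxE.
split=> [|j jn|j jn|]; rewrite ?s00 //.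
- by rewrite (s0j (Ordinal jn)) normrM -mulrnAr ger_pMr ?normr_gt0 // tP.
- rewrite (sE (Ordinal jn) (Ordinal jn)) qf_row -map_row U1min //.
  exact: row_unit_neq0.
apply: U'red => i j; rewrite /schur s00.
rewrite (sE (r i) (r j)) (sE (r i) i0) (sE i0 (r j)) !S'E /S' /i0 /r.
rewrite block_mxEur block_mxEdl block_mxEdr [X in X - _]mxE.
by rewrite [X in _ + X - _]mxE [X in a^-1 * X]mxE big_ord1 [a^-1 * _]mulrC addrK.
Qed.

(** * Bounds for the Gram-Schmidt norms of a reduced basis *)

Definition gs (s : nat -> nat -> rat) (i : nat) : rat := iter i schur s 0%N 0%N.

Lemma gsS s i : gs s i.+1 = gs (schur s) i.
Proof. by rewrite /gs iterSr. Qed.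

Lemma fredW n s : fred n.+1 s -> fred n s.
Proof.
elim: n s => // n IHn s [s0 sj sjj /IHn sr]; split=> // j lt_jn.
  exact/sj/ltnW.
exact/sjj/ltnW.
Qed.

Lemma fred_leq m n s : (m <= n)%N -> fred n s -> fred m s.
Proof.
move=> le_mn; rewrite -(subnK le_mn); elim: (n - m)%N => // k IHk.
by rewrite addSn => /fredW.
Qed.

Lemma quarter_sq (a b : rat) : a != 0 -> `|b| *+ 2 <= `|a| -> `|b ^+ 2 / a| <= `|a| / 4%:R.
Proof.
rewrite -normr_gt0 => a0 le_ba; rewrite normrM normfV normrX ler_pdivrMr //.
have := normr_ge0 b; move: le_ba a0; move: `|b| `|a| => {b a} b a; nra.
Qed.

Lemma schur_sym s : (forall j k, s j k = s k j) -> forall j k, schur s j k = schur s k j.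
Proof.
by move=> h j k; rewrite /schur (h j.+1 k.+1) (h j.+1 0%N) (h k.+1 0%N) [X in _ - X / _]mulrC.
Qed.

(** Lovasz's inequality: the next diagonal entry is at least |s_00| in absolute value, and
    projection changes it by s_01^2 / s_00, at most a quarter of |s_00|. *)
Lemma fred_gs_le n s i : (forall j k, s j k = s k j) -> fred n s -> (i.+1 < n)%N ->
  3%:R / 4%:R * `|gs s i| <= `|gs s i.+1|.
Proof.
elim: n s i => // n IHn s [|i] syms [s0 sj sjj sr] lt_in; last first.
  by rewrite !(gsS s) IHn //; apply: schur_sym.
case: n => [|n] // in IHn sj sjj sr lt_in *.
have := quarter_sq s0 (sj 0%N isT); have := sjj 1%N isT.
rewrite gsS /gs /= /schur (syms 1%N) -expr2; set e := _ ^+ 2 / _ => le1 le2.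
have := lerB_dist (s 1%N 1%N) e; lra.
Qed.

(** Pythagoras: [e i] is the contribution mu^2 r_i of the i-th Gram-Schmidt direction, where |mu| <=
    1/2 by size reduction. The value of [e 0] is recorded because it controls the entry [s 0 j]
    itself. *)
Lemma fred_diag n s j : (forall j k, s j k = s k j) -> fred n s -> (j < n)%N ->
  exists e : nat -> rat, [/\ s j j = gs s j + \sum_(i < j) e i,
    forall i, (i < j)%N -> 0 <= e i * gs s i /\ `|e i| <= `|gs s i| / 4%:R &
    (0 < j)%N -> e 0%N = s 0%N j ^+ 2 / s 0%N 0%N].
Proof.
elim: n s j => // n IHn s [|j] syms [s0 sj sjj sr] lt_jn.
  by exists (fun _ => 0); split=> //; rewrite big_ord0 addr0.
have [e [eE ebd _]] := IHn _ j (schur_sym syms) sr lt_jn.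
exists (fun i => if i is i'.+1 then e i' else s 0%N j.+1 ^+ 2 / s 0%N 0%N); split=> //.
  rewrite big_ord_recl /= gsS addrCA -eE /schur (syms j.+1) -expr2.
  by rewrite addrC subrK.
case=> [_|i /ebd]; last by rewrite gsS.
split; last exact/quarter_sq/sj.
by rewrite /gs /= mulfVK ?sqr_ge0.
Qed.

(** Iteration gives f i >= (3/4)^i f 0, and the exponents 0, ..., m - 1 add up to ['C(m, 2)]. *)
Lemma prod_geom (f : nat -> rat) m :
    (forall i, 0 <= f i) ->
    (forall i, (i.+1 < m)%N -> 3%:R / 4%:R * f i <= f i.+1) ->
  f 0%N ^+ m * (3%:R / 4%:R) ^+ 'C(m, 2) <= \prod_(i < m) f i.
Proof.
elim: m f => [|m IHm] f f0 fS; first by rewrite big_ord0 mulr1.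
rewrite big_ord_recl exprS binS bin1 exprD -mulrA ler_wpM2l //.
have [->|m0] := posnP m; first by rewrite big_ord0 mulr1.
apply: le_trans (IHm (fun i => f i.+1) _ _) => // [|i lt_im]; last exact: fS.
rewrite mulrA mulrAC ler_wpM2r ?exprn_ge0 // -exprMn_comm; last exact: mulrC.
by rewrite lerXn2r ?nnegrE ?mulr_ge0 // mulrC fS.
Qed.

Lemma fred_prod n s p m : (forall j k, s j k = s k j) -> fred n s -> (p + m)%N = n ->
  `|gs s p| ^+ m * (3%:R / 4%:R) ^+ 'C(m, 2) <= `|\prod_(i < m) gs s (p + i)|.
Proof.
move=> syms sr defn; rewrite normr_prod.
rewrite -{1}[p]addn0; apply: (prod_geom (f := fun i => `|gs s (p + i)|)) => // i lt_im.
by rewrite addnS (fred_gs_le syms sr) // -defn -addnS ltn_add2l.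
Qed.

(** Gaussian elimination in the first column leaves the block [schur s]. *)
Lemma det_fred n (S : 'M[rat]_n) (s : nat -> nat -> rat) :
    (forall i j : 'I_n, s i j = S i j) -> fred n s ->
  \det S = \prod_(i < n) gs s i.
Proof.
elim: n S s => [|n IHn] S s sE; first by rewrite det_mx00 big_ord0.
case=> s0 _ _ sr; rewrite big_ord_recl; under eq_bigr do rewrite lift0 gsS.
rewrite -(IHn (\matrix_(i, j) schur s i j) (schur s)) // => [|i j]; last by rewrite mxE.
pose S1 : 'M_(1 + n) := S.
pose L : 'M_(1 + n) := block_mx 1%:M 0 (- (s 0%N 0%N)^-1 *: dlsubmx S1) 1%:M.
have ulE : ulsubmx S1 = (s 0%N 0%N)%:M.
  rewrite [LHS]mx11_scalar !mxE; congr _%:M; symmetry.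
  exact: (sE (@lshift 1 n 0) (@lshift 1 n 0)).
have -> : \det S = \det (L *m S1) by rewrite det_mulmx det_lblock !det1 !mul1r.
rewrite -[S1]submxK mulmx_block !mul1mx !mul0mx !addr0 ulE mul_mx_scalar.
rewrite scalerA mulrN divff // scaleN1r addNr det_ublock det_scalar1.
congr (_ * \det _); apply/matrixP => i j.
rewrite !mxE big_ord1 !mxE /schur.
rewrite (sE (@rshift 1 n i) (@rshift 1 n j)) (sE (@rshift 1 n i) (@lshift 1 n 0)).
rewrite (sE (@lshift 1 n 0) (@rshift 1 n j)) /S1.
by rewrite /gs; ring.
Qed.

(** The product is a leading minor. Integrality of these minors later confines the Gram-Schmidt
    norms to finitely many values. *)
Lemma fred_minor_int n s p (g : nat -> nat -> int) :
    (forall i j, s i j = (g i j)%:~R) -> fred n s -> (p <= n)%N ->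
  exists d : int, \prod_(i < p) gs s i = d%:~R.
Proof.
move=> sE sr le_pn; exists (\det (\matrix_(i < p, j < p) g i j)).
rewrite -det_map_mx; symmetry; apply: det_fred (fred_leq le_pn sr) => i j.
by rewrite !mxE.
Qed.

Lemma fred_diag_pos n s j : (forall j k, s j k = s k j) -> fred n s -> (j < n)%N ->
    (forall i, (i < j)%N -> 0 < gs s i) ->
  [/\ gs s j <= s j j, s j j <= gs s j + (\sum_(i < j) gs s i) / 4%:R &
      (0 < j)%N -> gs s j + s 0%N j ^+ 2 / s 0%N 0%N <= s j j].
Proof.
move=> syms sr lt_jn gs_gt0; have [e [-> ebd e0]] := fred_diag syms sr lt_jn.
have e_ge0 i : (i < j)%N -> 0 <= e i.
  by move=> lt_ij; have [+ _] := ebd i lt_ij; rewrite pmulr_lge0 ?gs_gt0.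
split.
- by rewrite lerDl sumr_ge0 // => i _; apply: e_ge0.
- rewrite lerD2l mulr_suml ler_sum // => i _.
  by have [_] := ebd i (ltn_ord i); rewrite (ger0_norm (e_ge0 i _)) // (gtr0_norm (gs_gt0 i _)).
- case: j => // j in lt_jn gs_gt0 ebd e0 e_ge0 * => _.
  rewrite big_ord_recl /= e0 // lerD2l lerDl sumr_ge0 // => i _.
  by apply: e_ge0; rewrite ltnS.
Qed.

Lemma ltr_exp_bound (x B C k : rat) m :
  0 <= B -> 0 <= k -> x ^+ m * k <= C -> C < B ^+ m * k -> x < B.
Proof.
move=> B0 k0 le1 lt2; rewrite ltNge; apply/negP => le_Bx.
suff le2 : B ^+ m * k <= x ^+ m * k by have := lt_le_trans lt2 (le_trans le2 le1); rewrite ltxx.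
by rewrite ler_wpM2r // lerXn2r // nnegrE // (le_trans B0).
Qed.

Definition anisoZ n (G : 'M[int]_n) := forall x : 'rV_n, x != 0 -> qf G x x != 0.

Lemma qf_rat n (G : 'M[int]_n) (x y : 'rV_n) : qf G%:rat x%:rat y%:rat = (qf G x y)%:~R.
Proof. by rewrite /qf map_trmx -!map_mxM mxE. Qed.

Lemma unit_det_sqr n (U : 'M[int]_n) : U \in unitmx -> \det U ^+ 2 = 1.
Proof.
rewrite unitmxE => /unitrP[y [/(congr1 absz)/eqP]]; rewrite abszM muln_eq1 => /andP[_ /eqP].
by move: (\det U) => d d1; rewrite -[d ^+ 2]/(d * d); nia.
Qed.

Lemma det_congr n (G U : 'M[int]_n) : U \in unitmx -> \det (U *m G *m U^T) = \det G.
Proof.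
by move/unit_det_sqr => U2; rewrite !det_mulmx det_tr mulrAC mulrC -expr2 U2 mulr1.
Qed.

Definition gram n (G : 'M[int]_n.+1) (i j : nat) : int := G (inord i) (inord j).

Lemma reduced_form n (G : 'M[int]_n.+1) : G^T = G -> anisoZ G ->
  exists2 U : 'M[int]_n.+1, U \in unitmx &
    let G' := U *m G *m U^T in
    fred n.+1 (fun i j => (gram G' i j)%:~R) /\
    forall y : 'rV_n.+1, y != 0 -> `|G' 0 0| <= `|qf G y y|.
Proof.
move=> symG aG.
have [|x x0|U Uu [Ured Umin]] := @reduced_basis _ G%:rat.
- by rewrite map_trmx symG.
- by rewrite qf_rat intr_eq0 aG.
have E i j : (U%:rat *m G%:rat *m U%:rat^T) i j = ((U *m G *m U^T) i j)%:~R.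
  by rewrite map_trmx -!map_mxM mxE.
exists U => //=; split=> [|y y0].
  by apply: Ured => i j; rewrite E /gram !inord_val.
by have := Umin y 0 y0 erefl; rewrite E qf_rat -!intr_norm ler_int.
Qed.

(** Once the product [d] of the first [p] norms is divided out, the determinant bounds the product
    of the remaining [m], which are at least [gs s p] times 1, 3/4, (3/4)^2, ... in absolute
    value. *)
Lemma gs_lt n s p m (B d D : rat) : (forall j k, s j k = s k j) -> fred n s -> (p + m)%N = n ->
    \prod_(i < p) gs s i = d -> `|\prod_(i < n) gs s i| <= D -> 0 <= B ->
    D < `|d| * (B ^+ m * (3%:R / 4%:R) ^+ 'C(m, 2)) -> `|gs s p| < B.
Proof.
move=> syms sr defn <- le_D B0 lt_D; subst n.
have k0 : 0 <= (3%:R / 4%:R : rat) ^+ 'C(m, 2) by apply: exprn_ge0; lra.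
have := fred_prod syms sr erefl; rewrite big_split_ord normrM /= in le_D.
set x := `|gs s p|; set e := `|\prod_(i < p) _| in lt_D le_D.
set y := `|_| in le_D *; set k := _ ^+ 'C(_, _) in k0 lt_D * => le_xy.
have e0 : 0 <= e by apply: normr_ge0.
have le1 : x ^+ m * (e * k) <= D by rewrite mulrCA (le_trans _ le_D) // ler_wpM2l.
by apply: (ltr_exp_bound B0 (mulr_ge0 e0 k0) le1); rewrite mulrCA.
Qed.

(* If the leading block has Gram-Schmidt norms at most 2, an integral vector whose
   projection to its span has norm less than 1/2 is orthogonal to it. *)
Lemma gs_eq_diag n s j : (forall j k, s j k = s k j) -> fred n s -> (j < n)%N ->
    (forall i, (i < j)%N -> exists z : int, s i j = z%:~R) ->
    (forall i, (i < j)%N -> 0 < gs s i <= 2%:R) ->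
  s j j < gs s j + 1 / 2%:R -> s j j = gs s j.
Proof.
elim: j n s => // j IHj [//|n] s syms sr lt_jn colz gs02 ltj.
have [s0 sj sjj sr'] := sr; have [z zE] := colz 0%N isT.
have /andP[s0_gt0 s0_le2] : 0 < s 0%N 0%N <= 2%:R := gs02 0%N isT.
have gs02' i : (i < j)%N -> 0 < gs (schur s) i <= 2%:R.
  by move=> lt_ij; rewrite -gsS gs02.
have z0 : z = 0.
  have [|_ _ /(_ isT) le_j] := fred_diag_pos syms sr lt_jn.
    by move=> i /gs02 /andP[].
  have : z%:~R ^+ 2 / s 0%N 0%N < 1 / 2%:R by rewrite -zE; lra.
  rewrite ltr_pdivrMr // => lt1.
  have : (z ^+ 2)%:~R < (1 : int)%:~R :> rat by rewrite rmorphXn /=; lra.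
  by rewrite ltr_int expr2; nia.
have Es k : schur s k j = s k.+1 j.+1 by rewrite /schur zE z0 mulr0 mul0r subr0.
rewrite -Es gsS; apply: (IHj n) => //; first exact: schur_sym.
  by move=> i lt_ij; rewrite Es; apply: colz.
by rewrite Es -gsS.
Qed.

(** * Minimal norm at least 2 is impossible in ranks 4 and 5 when the determinant is -1, -3 or -9 *)

Section NoSmallForm.

Variables (n : nat) (G : 'M[int]_n.+1) (D : int).
Hypothesis D_val : (D == 1) || (D == 3) || (D == 9).
Hypothesis symG : G^T = G.
Hypothesis detG : \det G = - D.
Let g := gram G.
Let s i j : rat := (g i j)%:~R.
Hypothesis sr : fred n.+1 s.
Hypothesis Gmin : forall y : 'rV_n.+1, y != 0 -> 2 <= `|qf G y y|.
Hypothesis SigG : forall x y : 'rV_n.+1,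
  qf G x x < 0 -> qf G x x * qf G y y <= qf G x y ^+ 2.
Let r := gs s.

Let syms i j : s i j = s j i.
Proof. by rewrite /s /g /gram -[in LHS]symG mxE. Qed.

Let prod_r : \prod_(i < n.+1) r i = (- D)%:~R.
Proof.
rewrite -detG -det_map_mx; symmetry; apply: det_fred sr => i j.
by rewrite /s /g /gram !inord_val mxE.
Qed.

Let le9 : `|\prod_(i < n.+1) r i| <= 9%:R.
Proof.
rewrite prod_r -intr_norm (_ : 9%:R = (9 : int)%:~R) // ler_int.
by move: D_val; lia.
Qed.

Let diag_ge2 i : (i <= n)%N -> 2 <= `|g i i|.
Proof.
move=> le_in; rewrite /g /gram.
have := Gmin (y := delta_mx 0 (inord i)); rewrite /qf -rowE trmx_delta -colE !mxE; apply.
by apply/eqP => /matrixP /(_ 0 (inord i)) /eqP; rewrite !mxE !eqxx.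
Qed.

(** Minimality at the sum of two basis vectors; it excludes orthogonal ones of norms 2 and -2. *)
Let pair_ge2 i : (0 < i <= n)%N -> 2 <= `|g 0 0 + 2 * g 0 i + g i i|.
Proof.
move=> /andP[i0 le_in]; rewrite /g /gram.
have i_neq0 : (inord i == inord 0 :> 'I_n.+1) = false.
  by apply/eqP => /(congr1 val); rewrite /= !inordK //; lia.
have := Gmin (y := delta_mx 0 (inord 0) + delta_mx 0 (inord i)).
rewrite /qf mulmxDl linearD /= mulmxDr !mulmxDl -!rowE !trmx_delta -!colE !mxE.
rewrite (_ : G (inord i) (inord 0) = G (inord 0) (inord i)); last by rewrite -[in LHS]symG mxE.
set a := G _ _; set b := G _ _; set c := G _ _ => h.
have {}h : 2 <= `|b + a + (a + c)|.
  apply: h; apply/eqP => /matrixP /(_ 0 (inord 0)) /eqP.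
  by rewrite !mxE !eqxx (eq_sym (inord 0)) i_neq0.
lia.
Qed.

Hypothesis n34 : n = 3 \/ n = 4.

(** Ranks 4 and 5 at once: from position [p] on there remain [m] or [m.+1] norms. The binomial
    coefficients enter as numerals, which leaves purely numerical inequalities. *)
Let gs_bound p m c c' (B d : rat) : (p + m = 4)%N -> 'C(m, 2) = c -> 'C(m.+1, 2) = c' ->
    (p <= n)%N -> \prod_(i < p) r i = d -> 0 <= B ->
    9%:R < `|d| * (B ^+ m * (3%:R / 4%:R) ^+ c) ->
    9%:R < `|d| * (B ^+ m.+1 * (3%:R / 4%:R) ^+ c') -> `|r p| < B.
Proof.
move=> pm4 <- <- le_pn dE B0 lt3 lt4; case: n34 => n_val.
  by apply: (gs_lt (m := m) syms sr _ dE le9 B0 lt3); rewrite n_val.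
by apply: (gs_lt (m := m.+1) syms sr _ dE le9 B0 lt4); rewrite n_val addnS pm4.
Qed.

Let g00 : g 0 0 = 2 \/ g 0 0 = -2.
Proof.
have : `|r 0| < 3%:R.
  apply: (gs_bound (d := 1) (add0n 4) (erefl 6%N) (erefl 10%N) (leq0n n)).
  - by rewrite big_ord0.
  - by lra.
  - by rewrite normr1; lra.
  - by rewrite normr1; lra.
rewrite /r /gs /= /s -intr_norm -[3%:R]/((3 : int)%:~R) ltr_int.
by have := diag_ge2 (leq0n n); lia.
Qed.

Let g01 : g 0 1 = 0 \/ g 0 1 ^+ 2 = 1.
Proof.
have [_ /(_ 0%N) + _ _] := sr; rewrite /s -!intr_norm -mulr_natr.
rewrite -[2%:R]/((2 : int)%:~R) -rmorphM /= ler_int => h.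
have {h} : `|g 0 1| * 2 <= `|g 0 0| by apply: h; case: n34 => ->.
by rewrite expr2; case: g00 => ->; nia.
Qed.

Let r1E : r 1 = (g 1 1)%:~R - (g 0 1)%:~R ^+ 2 / (g 0 0)%:~R.
Proof. by rewrite /r /gs /= /schur (syms 1) -expr2. Qed.

Let stage1 : g 0 0 = 2 /\ g 1 1 = 2.
Proof.
have n1 : (1 <= n)%N by case: n34 => ->.
have n00 : `|g 0 0| = 2 by case: g00 => ->.
(* 2 (9/4)^4 (3/4)^6 is just above 9, and 9/4 is below 5/2, so [g 1 1], which differs from [r 1] by
   at most 1/2, stays below 3 in absolute value. *)
have r1_lt : `|r 1| < 9%:R / 4%:R.
  apply: (gs_bound (p := 1) (d := (g 0 0)%:~R) erefl (erefl 3%N) (erefl 6%N) n1).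
  - by rewrite big_ord1.
  - by lra.
  - by rewrite -intr_norm n00; lra.
  - by rewrite -intr_norm n00; lra.
have g11_ge2 := diag_ge2 n1; have g11_pair := pair_ge2 (i := 1) n1.
have g01_rat : g 0 1 = 0 /\ r 1 = (g 1 1)%:~R \/
    g 0 1 ^+ 2 = 1 /\ r 1 = (g 1 1)%:~R - 1 / (g 0 0)%:~R.
  rewrite r1E; case: g01 => g01E; [left|right]; split=> //.
    by rewrite g01E expr0n mul0r subr0.
  by rewrite -rmorphXn g01E.
have sig : g 0 0 < 0 -> g 0 0 * g 1 1 <= g 0 1 ^+ 2.
  have := @SigG (delta_mx 0 (inord 0)) (delta_mx 0 (inord 1)).
  by rewrite /qf -!rowE !trmx_delta -!colE !mxE.
move: r1_lt; rewrite ltr_norml => /andP[lb ub].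
have {lb ub} : - 3 < g 1 1 < 3 /\
    (g 0 1 ^+ 2 = 1 -> g 0 0 = 2 -> -2 < g 1 1) /\
    (g 0 1 ^+ 2 = 1 -> g 0 0 = -2 -> g 1 1 < 2).
  rewrite -!(ltr_int rat); case: g00 g01_rat => -> [] [-> rE]; rewrite rE in lb ub;
    (split; [apply/andP; split|split=> // _ _]); rewrite ?expr0n; lra.
(* Opposite signs are left only with [g 0 1 = 0], and then the sum of the two vectors has norm 0;
   two negative norms contradict the reverse Cauchy-Schwarz inequality. *)
by case: g00 g01_rat => E [] [E2 _]; rewrite E E2 in g11_ge2 g11_pair sig *;
  lia.
Qed.

Let s01 : s 0 0 = 2%:R /\ (s 0 1 = 0 \/ s 0 1 ^+ 2 = 1).
Proof.
rewrite /s; have [-> _] := stage1; split=> //.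
by case: g01 => [->|E]; [left|right; rewrite -rmorphXn E].
Qed.

Let r1_val : r 1 = 2%:R \/ r 1 = 3%:R / 2%:R.
Proof.
rewrite r1E -/(s 0 1) -/(s 0 0); have [_ ->] := stage1; have [-> [->|->]] := s01.
  by left; rewrite expr0n mul0r subr0.
by right; lra.
Qed.

Let minor p : (p <= n.+1)%N -> exists d : int, \prod_(i < p) r i = d%:~R.
Proof. exact: fred_minor_int sr. Qed.

Let r0_val : r 0 = 2%:R. Proof. by have [] := s01. Qed.

Let r_le i : (i < n)%N -> 3%:R / 4%:R * `|r i| <= `|r i.+1|.
Proof. by move=> lt_in; apply: (fred_gs_le syms sr). Qed.

Let diag_rat i : (i <= n)%N -> (g i i)%:~R <= (-2%:R : rat) \/ 2%:R <= ((g i i)%:~R : rat).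
Proof.
move=> /diag_ge2 h; have [h1|h1] : g i i <= -2 \/ 2 <= g i i by lia.
  by left; rewrite -(ler_int rat) in h1.
by right; rewrite -(ler_int rat) in h1.
Qed.

(** The determinant bounds [r 2] from above and 3/4 r 1 bounds it from below; as the third leading
    minor is an integer, only these values survive. *)
Let stage2 : 0 < r 2 /\ (r 1 = 2%:R /\ r 2 = 3%:R / 2%:R \/
  r 1 = 3%:R / 2%:R /\ (r 2 = 4%:R / 3%:R \/ r 2 = 5%:R / 3%:R \/ r 2 = 2%:R)).
Proof.
have n2 : (2 <= n)%N by case: n34 => ->.
have [d3 d3E] := minor (n2 : (3 <= n.+1)%N).
rewrite !big_ord_recr big_ord0 /= r0_val mul1r in d3E.
have [||le1 le2 /(_ isT)] := fred_diag_pos (j := 2) syms sr; rewrite -/r => //.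
  by case=> [|[|]] //; rewrite -/(r _) ?r0_val //; case: r1_val => ->.
have [-> _] := s01; rewrite !big_ord_recr big_ord0 /= add0r -!/(r _) r0_val in le2 *.
rewrite -/(r 2) in le1; move=> le3; have le4 := r_le n2; have a2 := diag_rat n2.
rewrite -/(s 2 2) in a2.
have r1n : `|r 1| = r 1.
  by case: r1_val => ->; [exact: normr_nat | apply: ger0_norm; lra].
rewrite r1n in le4; clear r1n.
have [r1E'|r1E'] := r1_val; rewrite r1E' in d3E le2 le4.
  have ub : `|r 2| < 7%:R / 4%:R.
    apply: (gs_bound (p := 2) (d := 4%:R) erefl (erefl 1%N) (erefl 3%N) n2).
    - by rewrite !big_ord_recr big_ord0 /= r0_val r1E' mul1r -natrM.
    - by lra.
    - by rewrite normr_nat; lra.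
    - by rewrite normr_nat; lra.
  have r2_gt0 : 0 < r 2.
    rewrite ltNge; apply/negP => r2_le0; rewrite (ler0_norm r2_le0) in ub le4.
    by lra.
  split; first exact: r2_gt0.
  left; split; first exact: r1E'.
  rewrite (gtr0_norm r2_gt0) in ub le4.
  have : d3 = 6.
    have : 6 <= d3 < 7 by rewrite -(ler_int rat) -(ltr_int rat) -d3E; apply/andP; split; lra.
    by clear; lia.
  by move=> d3v; rewrite d3v in d3E; lra.
have ub : `|r 2| < 9%:R / 4%:R.
  apply: (gs_bound (p := 2) (d := 3%:R) erefl (erefl 1%N) (erefl 3%N) n2).
  - by rewrite !big_ord_recr big_ord0 /= r0_val r1E'; lra.
  - by lra.
  - by rewrite normr_nat; lra.
  - by rewrite normr_nat; lra.
(* Otherwise the third basis vector has norm -2 and is orthogonal to the first, of norm 2, so that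
   their sum has norm 0. *)
have r2_gt0 : 0 < r 2.
  rewrite ltNge; apply/negP => r2_le0; rewrite (ler0_norm r2_le0) in ub le4.
  have lb : -2%:R <= r 2.
    have lt7 : -7 < d3 by rewrite -(ltr_int rat) -d3E; lra.
    have : -6 <= d3 by move: lt7; clear; lia.
    by rewrite -(ler_int rat) -d3E; lra.
  have E : s 2 2 = -2%:R by lra.
  have s02 : g 0 2 = 0.
    have : s 0 2 ^+ 2 <= 0 by lra.
    by rewrite le_eqVlt ltNge sqr_ge0 orbF sqrf_eq0 intr_eq0 => /eqP.
  have := pair_ge2 (i := 2) n2; rewrite s02.
  have -> : g 2 2 = - 2 by apply/eqP; rewrite -(eqr_int rat) -/(s 2 2) E.
  by have [-> _] := stage1.
split; first exact: r2_gt0.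
right; split; first exact: r1E'.
rewrite (gtr0_norm r2_gt0) in ub le4.
have : 3 < d3 < 7 by rewrite -!(ltr_int rat) -d3E; apply/andP; split; lra.
move=> d3b; have : d3 = 4 \/ d3 = 5 \/ d3 = 6 by move: d3b; clear; lia.
by case=> [|[]] d3v; rewrite d3v in d3E; [left|right; left|right; right]; lra.
Qed.

(** As the sum is below 7, the last diagonal entry is below r_n + 7/4 < 2, hence at most -2. As D <=
    9 and d >= 4, also r_n >= -9/4. The two therefore differ by less than 1/2, so [gs_eq_diag] makes
    them equal, to -2, and D = 2d' for the integer minor d'. *)
Let last_norm (k : nat) (d : rat) : k = n -> \prod_(i < k) r i = d -> 4%:R <= d ->
  (forall i, (i < k)%N -> 0 < r i <= 2%:R) -> \sum_(i < k) r i < 7%:R -> False.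
Proof.
move=> kn; subst k => dE d4 rb sum7.
have Dle : (D%:~R : rat) = 1 \/ (D%:~R : rat) = 3%:R \/ (D%:~R : rat) = 9%:R.
  by case/orP: D_val => [/orP[]|] /eqP ->; [left|right; left|right; right].
have rnE : d * r n = - D%:~R by have := prod_r; rewrite big_ord_recr /= dE rmorphN.
have [|le1 le2 _] := fred_diag_pos syms sr (ltnSn n); first by move=> i /rb /andP[].
rewrite -/r in le1 le2; have an := diag_rat (leqnn n); rewrite -/(s n n) in an.
have rn_lt0 : r n < 0 by nra.
have rn_ge : - 9%:R / 4%:R <= r n by nra.
have an_le : s n n <= - 2%:R by lra.
have : s n n = gs s n.
  apply: (gs_eq_diag syms sr (ltnSn n)).
  - by move=> i _; exists (g i n).
  - exact: rb.
  - by rewrite -/r; lra.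
rewrite -/r => anE; have [d' d'E] := minor (leqnSn n); rewrite dE in d'E.
have gn : g n n = -2.
  have : -3 < g n n <= -2.
    by rewrite -(ltr_int rat) -(ler_int rat) -/(s n n); apply/andP; split; lra.
  by clear; lia.
rewrite -anE /s gn d'E in rnE.
have : d' * 2 = D by apply/eqP; rewrite -(eqr_int rat) rmorphM /=; apply/eqP; lra.
by move: D_val; clear; lia.
Qed.

Let prod2 : \prod_(i < 2) r i = r 0 * r 1.
Proof. by rewrite !big_ord_recr big_ord0 /= mul1r. Qed.

(* The reduction inequalities force all Gram-Schmidt norms but the last to be in
   (0, 2], with product at least 4; the last basis vector is then orthogonal to
   the others and has norm -2, so D would be even. *)
Lemma no_small_form : False.
Proof.
have [r2_gt0 r12] := stage2; have r1_gt0 : 0 < r 1 by case: r1_val => ->; lra.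
have r0_gt0 : 0 < r 0 by rewrite r0_val.
case: n34 => [n3|n4].
  apply: (@last_norm 3 (r 0 * r 1 * r 2)); first by [].
  - by rewrite big_ord_recr prod2.
  - by rewrite r0_val; case: r12 => [[-> ->]|[-> [|[]] ->]]; lra.
  - move=> [|[|[|i]]] // _; rewrite ?r0_val ?r1_gt0 ?r2_gt0 //=.
      by case: r1_val => ->; lra.
    by case: r12 => [[_ ->]|[_ [|[]] ->]]; lra.
  - rewrite !big_ord_recr big_ord0 /= r0_val.
    by case: r12 => [[-> ->]|[-> [|[]] ->]]; lra.
have n4' : (3 <= n)%N by rewrite n4.
have le4 : 3%:R / 4%:R * `|r 2| <= `|r 3| by apply: r_le; rewrite n4.
have [d4 d4E] := minor (n4' : (4 <= n.+1)%N).
have prod3 : \prod_(i < 3) r i = r 0 * r 1 * r 2 by rewrite big_ord_recr prod2.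
have prod4 : \prod_(i < 4) r i = r 0 * r 1 * r 2 * r 3 by rewrite big_ord_recr prod3.
have [||le1 le2 _] := fred_diag_pos (j := 3) syms sr; rewrite -/r => //.
  by case=> [|[|[|]]].
rewrite -/r in le1 le2; rewrite !big_ord_recr big_ord0 /= add0r r0_val in le2.
have a3 := diag_rat n4'; rewrite -/(s 3 3) in a3.
have ub d (B : rat) : r 0 * r 1 * r 2 = d -> 0 <= d -> 0 <= B ->
    9%:R < d * (B ^+ 2 * (3%:R / 4%:R)) -> `|r 3| < B.
  move=> dE d0 B0 ltB; rewrite -(ger0_norm d0) in ltB.
  apply: (gs_lt (p := 3) (m := 2) (d := d) syms sr _ _ le9 B0 ltB).
    by rewrite n4.
  by rewrite -dE -prod3.
rewrite prod4 r0_val in d4E.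
suff [r3_gt0 r3_lt sum_lt d_ge4] : [/\ 0 < r 3, r 3 < 7%:R / 4%:R,
    2%:R + r 1 + r 2 + r 3 < 7%:R & 4%:R <= r 0 * r 1 * r 2 * r 3].
  apply: (@last_norm 4 _ _ prod4); [by [] | exact: d_ge4 | | ].
  - move=> [|[|[|[|i]]]] // _; rewrite ?r0_val ?r1_gt0 ?r2_gt0 ?r3_gt0 //=.
    + by case: r1_val => ->; lra.
    + by case: r12 => [[_ ->]|[_ [|[]] ->]]; lra.
    + by lra.
  - by rewrite !big_ord_recr big_ord0 /= r0_val add0r.
(* With [r 3] nonpositive, [g 3 3] would lie strictly between -2 and 2. *)
have r3_gt0 B : `|r 3| < B -> B <= 7%:R / 4%:R ->
    (2%:R + r 1 + r 2) / 4%:R < 3%:R / 4%:R * r 2 + 2%:R -> 0 < r 3.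
  move=> ltB leB sum_lt; rewrite ltNge; apply/negP => r3_le0.
  by rewrite (ler0_norm r3_le0) (gtr0_norm r2_gt0) in ltB le4; lra.
rewrite r0_val in ub *; rewrite (gtr0_norm r2_gt0) in le4.
case: r12 => [[r1v r2v]|[r1v [|[]] r2v]]; rewrite r1v r2v in ub r3_gt0 le4 d4E *.
- have lt3 : `|r 3| < 3%:R / 2%:R by apply: (ub 6%:R); lra.
  have r3p : 0 < r 3 by apply: (r3_gt0 _ lt3); lra.
  by rewrite (gtr0_norm r3p) in lt3 le4; split; lra.
- have lt3 : `|r 3| < 7%:R / 4%:R by apply: (ub 4%:R); lra.
  have r3p : 0 < r 3 by apply: (r3_gt0 _ lt3); lra.
  by rewrite (gtr0_norm r3p) in lt3 le4; split; lra.
- have lt3 : `|r 3| < 31%:R / 20%:R by apply: (ub 5%:R); lra.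
  have r3p : 0 < r 3 by apply: (r3_gt0 _ lt3); lra.
  by rewrite (gtr0_norm r3p) in lt3 le4; split; lra.
(* This case is void: here 3/4 r 2 = 3/2 is a lower bound for |r 3|. *)
- have lt3 : `|r 3| < 3%:R / 2%:R by apply: (ub 6%:R); lra.
  by lra.
Qed.

End NoSmallForm.

(** * Diagonalization of forms with discriminant killed by 3 *)

(* The reverse Cauchy-Schwarz inequality: G has at most one negative direction. *)
Definition hyperbolic n (G : 'M[int]_n) := forall x y : 'rV_n,
  qf G x x < 0 -> qf G x x * qf G y y <= qf G x y ^+ 2.

Definition posdef n (G : 'M[int]_n) := forall x : 'rV_n, x != 0 -> 0 < qf G x x.

(* G has discriminant group killed by 3, and N is 3 times the inverse of G. *)
Definition dual_pair n (G N : 'M[int]_n) :=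
  [/\ G^T = G, N^T = N, G *m N = 3%:M & N *m G = 3%:M].

Definition diag13 n (G : 'M[int]_n) := exists2 U : 'M[int]_n, U \in unitmx &
  let M := U *m G *m U^T in
  is_diag_mx M /\ forall i, `|M i i| = 1 \/ `|M i i| = 3.

(** Orthogonal sum of the rank one form [a] and [H]. The size is written [n.+1] so that summands can
    be split off repeatedly; block lemmas for size [1 + n] are reached by conversion. *)
Definition bcons n (a : int) (H : 'M[int]_n) : 'M[int]_n.+1 :=
  block_mx (a%:M : 'M_1) 0 0 H.

Definition vcons n (a : int) (x : 'rV[int]_n) : 'rV[int]_n.+1 :=
  row_mx (a%:M : 'M_1) x.

Lemma vconsP n (x : 'rV[int]_n.+1) : exists a y, x = vcons a y.
Proof.
exists (lsubmx (x : 'rV_(1 + n)) 0 0), (rsubmx (x : 'rV_(1 + n))).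
by rewrite /vcons -mx11_scalar hsubmxK.
Qed.

Lemma vcons_eq0 n a (x : 'rV[int]_n) : (vcons a x == 0) = (a == 0) && (x == 0).
Proof.
rewrite -[LHS]/(row_mx (a%:M : 'M_1) x == 0 :> 'rV_(1 + n)) row_mx_eq0.
congr (_ && _).
by apply/eqP/eqP => [/matrixP/(_ 0 0)|->]; rewrite ?raddf0 // !mxE.
Qed.

Lemma qf_bcons n a (H : 'M[int]_n) s t x y :
  qf (bcons a H) (vcons s x) (vcons t y) = a * s * t + qf H x y.
Proof.
rewrite -[LHS]/(@qf int (1 + n) (block_mx (a%:M : 'M_1) 0 0 H)
  (row_mx (s%:M : 'M_1) x) (row_mx (t%:M : 'M_1) y)).
rewrite /qf mul_row_block tr_row_mx !mulmx0 addr0 add0r mul_row_col tr_scalar_mx.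
by rewrite -!scalar_mxM !mxE mulr1n (mulrC s).
Qed.

Lemma qf_sym n (G : 'M[int]_n) x y : G^T = G -> qf G x y = qf G y x.
Proof.
move=> symG; rewrite /qf -[in RHS]symG.
by rewrite -[y in RHS]trmxK -!trmx_mul [RHS]mxE mulmxA.
Qed.

Lemma qfDl n (G : 'M[int]_n) x y z : qf G (x + y) z = qf G x z + qf G y z.
Proof. by rewrite /qf !mulmxDl mxE. Qed.

Lemma qfDr n (G : 'M[int]_n) x y z : qf G x (y + z) = qf G x y + qf G x z.
Proof. by rewrite /qf linearD /= mulmxDr mxE. Qed.

Lemma qfZl n (G : 'M[int]_n) a x y : qf G (a *: x) y = a * qf G x y.
Proof. by rewrite -[in LHS](scale1r y) qf_scale mulr1. Qed.

Lemma qfZr n (G : 'M[int]_n) a x y : qf G x (a *: y) = a * qf G x y.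
Proof. by rewrite -[in LHS](scale1r x) qf_scale mul1r. Qed.

Section Congruence.

Variables (n : nat) (G U : 'M[int]_n).
Hypothesis Uu : U \in unitmx.
Let G' := U *m G *m U^T.

Lemma sym_congr : G^T = G -> G'^T = G'.
Proof. by move=> symG; rewrite !trmx_mul trmxK symG mulmxA. Qed.

Lemma hyperbolic_congr : hyperbolic G -> hyperbolic G'.
Proof. by move=> hG x y; rewrite !qf_congr; apply: hG. Qed.

Lemma posdef_congr : posdef G -> posdef G'.
Proof. by move=> pG x x0; rewrite qf_congr pG // mulmx_unit_neq0. Qed.

Lemma anisoZ_congr : anisoZ G -> anisoZ G'.
Proof. by move=> aG x x0; rewrite qf_congr aG // mulmx_unit_neq0. Qed.

Lemma diag13_congr : diag13 G' -> diag13 G.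
Proof.
case=> V Vu MV; exists (V *m U); first by rewrite unitmx_mul Vu.
by rewrite trmx_mul !mulmxA in MV *.
Qed.

Lemma dual_pair_congr N : dual_pair G N ->
  dual_pair G' ((invmx U)^T *m N *m invmx U).
Proof.
case=> symG symN GN NG; have Ut : U^T *m (invmx U)^T = 1%:M.
  by rewrite -trmx_mul mulVmx // trmx1.
split; first exact: sym_congr.
- by rewrite !trmx_mul trmxK symN mulmxA.
- rewrite /G' !mulmxA -(mulmxA (U *m G)) Ut mulmx1 -(mulmxA U) GN.
  by rewrite mul_mx_scalar -scalemxAl mulmxV // scalemx1.
- rewrite /G' !mulmxA -(mulmxA (_ *m N)) mulVmx // mulmx1 -(mulmxA _ N) NG.
  by rewrite mul_mx_scalar -scalemxAl -trmx_mul mulmxV // trmx1 scalemx1.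
Qed.

End Congruence.

Lemma dual_pair_sym n (G N : 'M[int]_n) : dual_pair G N -> dual_pair N G.
Proof. by case. Qed.

Lemma scalemx_inj m n (A : 'M[int]_(m, n)) c : c != 0 -> c *: A = 0 -> A = 0.
Proof.
move=> c0 /matrixP cA; apply/matrixP => i j; have /eqP := cA i j.
by rewrite !mxE mulf_eq0 (negPf c0) => /eqP.
Qed.

Lemma dual_pair_inj n (G N : 'M[int]_n) (x : 'rV_n) : dual_pair G N -> x *m G = 0 -> x = 0.
Proof.
case=> _ _ GN _ xG; have : x *m (G *m N) = 0 by rewrite mulmxA xG mul0mx.
by rewrite GN mul_mx_scalar; apply: scalemx_inj.
Qed.

Lemma dual_pairP n (G N : 'M[int]_n) : G^T = G -> G *m N = 3%:M -> dual_pair G N.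
Proof.
move=> symG GN; have NtG : N^T *m G = 3%:M by rewrite -symG -trmx_mul GN tr_scalar_mx.
have symN : N^T = N.
  have : N^T *m (G *m N) = N^T *m G *m N by rewrite mulmxA.
  rewrite NtG GN mul_mx_scalar mul_scalar_mx => /eqP; rewrite -subr_eq0 -scalerBr.
  by move=> /eqP /scalemx_inj /eqP; rewrite subr_eq0 => /(_ isT) /eqP.
by split; rewrite // -symN.
Qed.

(** Multiplication by [N] embeds the form [N], scaled by 3, into [G]. This carries anisotropy,
    definiteness and the reverse Cauchy-Schwarz inequality over to [N]. *)
Lemma qf_dual n (G N : 'M[int]_n) (x y : 'rV_n) : dual_pair G N ->
  qf G (x *m N) (y *m N) = 3 * qf N x y.
Proof.
case=> _ symN _ NG; rewrite /qf trmx_mul symN !mulmxA -(mulmxA x N) NG.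
by rewrite mul_mx_scalar -!scalemxAl mxE.
Qed.

Lemma dual_mul_neq0 n (G N : 'M[int]_n) (x : 'rV_n) :
  dual_pair G N -> x != 0 -> x *m N != 0.
Proof. by move=> /dual_pair_sym dG; apply: contraNneq => /(dual_pair_inj dG)->. Qed.

Lemma hyperbolic_dual n (G N : 'M[int]_n) : dual_pair G N -> hyperbolic G -> hyperbolic N.
Proof.
move=> dG hG x y; have := hG (x *m N) (y *m N); rewrite !(qf_dual _ _ dG).
by rewrite !expr2; nia.
Qed.

Lemma posdef_dual n (G N : 'M[int]_n) : dual_pair G N -> posdef G -> posdef N.
Proof.
move=> dG pG x x0; have := pG _ (dual_mul_neq0 dG x0); rewrite (qf_dual _ _ dG); lia.
Qed.

Lemma anisoZ_dual n (G N : 'M[int]_n) : dual_pair G N -> anisoZ G -> anisoZ N.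
Proof.
move=> dG aG x x0; have := aG _ (dual_mul_neq0 dG x0); rewrite (qf_dual _ _ dG).
by rewrite mulf_eq0 negb_or => /andP[].
Qed.

Lemma det_dual n (G N : 'M[int]_n) : dual_pair G N -> \det G * \det N = 3 ^+ n.
Proof. by case=> _ _ GN _; rewrite -det_mulmx GN det_scalar. Qed.

Lemma det_dual_abs n (G N : 'M[int]_n) : dual_pair G N ->
  exists2 k, (k <= n)%N & absz (\det G) = (3 ^ k)%N /\ absz (\det N) = (3 ^ (n - k))%N.
Proof.
move=> /det_dual /(congr1 absz); rewrite abszM abszX /= => dE.
have : (absz (\det G) %| 3 ^ n)%N by rewrite -dE dvdn_mulr.
case/(dvdn_pfactor _ _ (isT : prime 3)) => k le_kn kE; exists k => //; split=> //.
apply/eqP; rewrite -(eqn_pmul2l (m := 3 ^ k)) ?expn_gt0 // -{1}kE dE -expnD.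
by rewrite subnKC.
Qed.

(** In the dual basis [G] becomes 3 times the inverse of the diagonal matrix, which exchanges 1 with
    3 and -1 with -3. *)
Lemma diag13_dual n (G N : 'M[int]_n) : dual_pair G N -> diag13 N -> diag13 G.
Proof.
move=> dG [U Uu [/is_diag_mxP Ud U13]]; exists (invmx U)^T; first by rewrite unitmx_tr unitmx_inv.
have [_ _ _] := dual_pair_congr Uu (dual_pair_sym dG); rewrite trmxK.
set M := _ *m G *m _; set M' := U *m _ *m _ in Ud U13 * => MM.
have ME i j : M i j * M' j j = 3 *+ (i == j).
  have /matrixP/(_ i j) := MM; rewrite [in X in _ = X -> _]mxE mxE (bigD1 j) //= big1 ?addr0 //.
  by move=> k kj; rewrite Ud ?mulr0.
split=> [|i]; last by have := ME i i; rewrite eqxx mulr1n; case: (U13 i); nia.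
apply/is_diag_mxP => i j ij; have := ME i j; rewrite -val_eqE (negPf ij) mulr0n.
by move=> /eqP; rewrite mulf_eq0 => /orP[/eqP//|/eqP v0]; case: (U13 j); rewrite v0.
Qed.

Lemma det_bcons n a (H : 'M[int]_n) : \det (bcons a H) = a * \det H.
Proof. by rewrite [LHS](det_ublock (a%:M : 'M_1) 0 H) det_scalar1. Qed.

Lemma bcons_sym n a (H : 'M[int]_n) : (bcons a H)^T = bcons a H -> H^T = H.
Proof.
move=> /matrixP symH; apply/matrixP => i j; have := symH (@rshift 1 n i) (@rshift 1 n j).
rewrite mxE /bcons => E; rewrite mxE.
have EH k l : (block_mx (a%:M : 'M_1) 0 0 H : 'M_(1 + n)) (rshift 1 k) (rshift 1 l) = H k l.
  by rewrite block_mxEdr.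
by rewrite -(EH i j) -(EH j i).
Qed.

Lemma hyperbolic_bcons n a (H : 'M[int]_n) : hyperbolic (bcons a H) -> hyperbolic H.
Proof.
move=> hG x y; have := hG (vcons 0 x) (vcons 0 y).
by rewrite !qf_bcons !mulr0 !add0r.
Qed.

Lemma anisoZ_bcons n a (H : 'M[int]_n) : anisoZ (bcons a H) -> anisoZ H.
Proof.
move=> aG x x0; have := aG (vcons 0 x); rewrite vcons_eq0 (negPf x0) andbF.
by rewrite qf_bcons !mulr0 add0r => ->.
Qed.

Lemma posdef_bcons n a (H : 'M[int]_n) : posdef (bcons a H) -> posdef H.
Proof.
move=> pG x x0; have := pG (vcons 0 x); rewrite vcons_eq0 (negPf x0) andbF.
by rewrite qf_bcons !mulr0 add0r => ->.
Qed.

Lemma posdef_aniso n (G : 'M[int]_n) : posdef G -> anisoZ G.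
Proof. by move=> pG x x0; rewrite gt_eqF ?pG. Qed.

Lemma dual_pair_bcons n a (H : 'M[int]_n) N : dual_pair (bcons a H) N ->
  exists2 H', dual_pair H H' & exists b, a * b = 3 /\ N = bcons b H'.
Proof.
case=> symG symN GN _; have symH := bcons_sym symG.
pose N1 : 'M_(1 + n) := N.
have GN1 : block_mx (a%:M : 'M_1) 0 0 H *m N1 = 3%:M by exact: GN.
move: GN1; rewrite -[N1]submxK mulmx_block !mul0mx !addr0 !add0r scalar_mx_block.
move=> /eq_block_mx[ul ur dl dr]; have dH := dual_pairP symH dr.
exists (drsubmx N1) => //; exists (ulsubmx N1 0 0); split.
  by have /matrixP/(_ 0 0) := ul; rewrite mul_scalar_mx !mxE eqxx !mulr1n.
have a0 : a != 0.
  apply: contra_eq_neq ul => ->; rewrite raddf0 mul0mx eq_sym.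
  by apply/eqP => /matrixP/(_ 0 0); rewrite !mxE.
have N12 : ursubmx N1 = 0 by apply: (scalemx_inj a0); rewrite -mul_scalar_mx.
have symN1 : N1^T = N1 by exact: symN.
have N21 : dlsubmx N1 = 0 by rewrite -symN1 -trmx_ursub N12 trmx0.
suff : N1 = block_mx (ulsubmx N1 0 0)%:M 0 0 (drsubmx N1) by [].
by rewrite -mx11_scalar -[LHS]submxK N12 N21.
Qed.

Lemma bcons_congr n a (H U : 'M[int]_n) :
  bcons 1 U *m bcons a H *m (bcons 1 U)^T = bcons a (U *m H *m U^T).
Proof.
suff : block_mx (1%:M : 'M_1) 0 0 U *m block_mx a%:M 0 0 H *m (block_mx 1%:M 0 0 U)^T
  = block_mx a%:M 0 0 (U *m H *m U^T) by [].
rewrite tr_block_mx !trmx0 tr_scalar_mx !mulmx_block.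
by rewrite !mul0mx !mulmx0 !mul1mx !mulmx1 !addr0 !add0r mul0mx.
Qed.

Lemma diag13_bcons n a (H : 'M[int]_n) : `|a| = 1 \/ `|a| = 3 ->
  diag13 H -> diag13 (bcons a H).
Proof.
move=> a13 [U Uu [/is_diag_mxP Ud U13]].
exists (bcons 1 U); first by rewrite unitmxE det_bcons mul1r -unitmxE.
rewrite bcons_congr.
suff : forall i j : 'I_(1 + n), (i != j :> nat ->
    (block_mx (a%:M : 'M_1) 0 0 (U *m H *m U^T)) i j = 0) /\
    (`|(block_mx (a%:M : 'M_1) 0 0 (U *m H *m U^T)) i i| = 1 \/
     `|(block_mx (a%:M : 'M_1) 0 0 (U *m H *m U^T)) i i| = 3).
  move=> h; split=> [|i]; last by have [_] := h i i.
  by apply/is_diag_mxP => i j ij; have [E _] := h i j; apply: E.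
move=> i j; split.
  case: (split_ordP i) => {i} i ->; case: (split_ordP j) => {j} j -> /=.
  - by rewrite (ord1 i) (ord1 j).
  - by rewrite block_mxEur mxE.
  - by rewrite block_mxEdl mxE.
  - by rewrite block_mxEdr eqn_add2l => /Ud.
case: (split_ordP i) => {}i ->; last by rewrite block_mxEdr.
by rewrite block_mxEul ord1 mxE eqxx mulr1n.
Qed.

Lemma sym_block n (G : 'M[int]_(1 + n)) : G^T = G ->
  G = block_mx (G 0 0)%:M (ursubmx G) (ursubmx G)^T (drsubmx G).
Proof.
move=> symG; rewrite -[LHS]submxK trmx_ursub symG; congr block_mx.
by rewrite [LHS]mx11_scalar !mxE (_ : lshift n 0 = 0) //; apply: val_inj.
Qed.

Lemma bcons_of_ur0 n (G : 'M[int]_n.+1) : G^T = G ->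
  (forall j : 'I_n, G 0 (@rshift 1 n j) = 0) -> exists H, G = bcons (G 0 0) H.
Proof.
move=> symG Gj; exists (drsubmx (G : 'M_(1 + n))).
suff -> : bcons (G 0 0) (drsubmx (G : 'M_(1 + n))) =
  block_mx (G 0 0)%:M (ursubmx (G : 'M_(1 + n))) (ursubmx (G : 'M_(1 + n)))^T
    (drsubmx (G : 'M_(1 + n))) by exact: sym_block.
have -> : ursubmx (G : 'M_(1 + n)) = 0; last by rewrite trmx0.
apply/matrixP => i j; rewrite !mxE ord1 -[RHS](Gj j).
by congr (G _ _); apply: val_inj.
Qed.

Lemma reduced_split n (G : 'M[int]_n.+1) : G^T = G ->
    fred n.+1 (fun i j => (gram G i j)%:~R) -> `|G 0 0| = 1 ->
  exists H, G = bcons (G 0 0) H.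
Proof.
move=> symG [_ s0j _ _] G1; apply: bcons_of_ur0 => // j.
have := s0j j (ltn_ord j); rewrite -!intr_norm -mulr_natr.
rewrite -[2%:R]/((2 : int)%:~R) -rmorphM /= ler_int /gram.
rewrite (_ : inord 0 = 0); last by apply: val_inj; rewrite /= inordK.
rewrite (_ : inord j.+1 = @rshift 1 n j); last by apply: val_inj; rewrite /= inordK ?ltnS.
by rewrite G1; lia.
Qed.

Lemma mulz1_sqr (a b : int) : a * b = 1 -> a * a = 1.
Proof.
move=> /(congr1 absz)/eqP; rewrite abszM muln_eq1 => /andP[/eqP + _]; lia.
Qed.

Lemma vcons_mul n s (x : 'rV[int]_n) a H : vcons s x *m bcons a H = vcons (s * a) (x *m H).
Proof.
suff : row_mx (s%:M : 'M_1) x *m block_mx (a%:M : 'M_1) 0 0 H = row_mx (s * a)%:M (x *m H) by [].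
by rewrite mul_row_block !mulmx0 addr0 add0r scalar_mxM.
Qed.

Lemma vconsZ n c s (x : 'rV[int]_n) : c *: vcons s x = vcons (c * s) (c *: x).
Proof.
suff : c *: row_mx (s%:M : 'M_1) x = row_mx (c * s)%:M (c *: x) by [].
by rewrite scale_row_mx scale_scalar_mx.
Qed.

Lemma vcons10 n : vcons 1 0 = delta_mx 0 0 :> 'rV[int]_n.+1.
Proof.
suff : row_mx (1%:M : 'M_1) 0 = (delta_mx 0 0 : 'rV[int]_(1 + n)) by [].
apply/matrixP => i j; rewrite ord1; case: (split_ordP j) => {}j ->.
  by rewrite row_mxEl !mxE ord1.
by rewrite row_mxEr !mxE.
Qed.

Lemma split_vector n (G : 'M[int]_n.+1) e x : G^T = G -> e * e = 1 -> qf G x x = e ->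
  exists2 U, U \in unitmx & vcons 1 0 *m U = x /\ exists H, U *m G *m U^T = bcons e H.
Proof.
move=> symG ee qx; have [d [U1 U1u xE]] := row_complete x.
have dd : d * d = 1.
  move: qx; rewrite xE qf_scale -mulrA => qx.
  by apply: (@mulz1_sqr _ (d * qf G (row 0 U1) (row 0 U1) * e)); rewrite mulrA qx.
(* The content [d] is 1 or -1, because its square divides a unit; the factor [bcons d 1%:M] makes
   [x] itself the first row. *)
pose U2 := bcons d 1%:M *m U1.
have U2u : U2 \in unitmx.
  rewrite unitmx_mul U1u unitmxE det_bcons det1 mulr1 andbT.
  by apply/unitrP; exists d.
have row2 : vcons 1 0 *m U2 = x.
  by rewrite /U2 mulmxA vcons_mul mul1r mul0mx xE rowE -vcons10 scalemxAl vconsZ mulr1 scaler0.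
pose G2 : 'M_(1 + n) := U2 *m G *m U2^T.
have symG2 : G2^T = G2 by exact: sym_congr.
have G200 : G2 0 0 = e.
  by rewrite -qx -row2 -qf_congr vcons10 /qf -rowE trmx_delta -colE !mxE.
pose c := ursubmx G2.
have G2E : G2 = block_mx e%:M c c^T (drsubmx G2) by rewrite -G200 -sym_block.
pose U3 : 'M_(1 + n) := block_mx 1%:M 0 (- e *: c^T) 1%:M.
have U3u : U3 \in unitmx by rewrite unitmxE det_lblock !det1 mulr1 unitr1.
exists (U3 *m U2); first by rewrite unitmx_mul U2u andbT; exact: U3u.
split.
  rewrite mulmxA -[in RHS]row2; congr (_ *m _).
  suff : row_mx (1%:M : 'M_1) 0 *m U3 = row_mx 1%:M 0 by [].
  by rewrite mul_row_block !mul1mx !mul0mx !addr0.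
exists (drsubmx G2 - e *: (c^T *m c)).
have -> : U3 *m U2 *m G *m (U3 *m U2)^T = U3 *m G2 *m U3^T.
  by rewrite /G2 trmx_mul !mulmxA.
rewrite G2E tr_block_mx trmx0 !trmx1 !mulmx_block !mul1mx !mul0mx !addr0 !mulmx1 !mulmx0.
rewrite linearZ /= trmxK mul_mx_scalar scalerA mulrN ee scaleN1r addNr.
rewrite !mul_scalar_mx scalerA mulrN ee scaleN1r mul0mx add0r addNr !addr0.
by rewrite -scalemxAl scaleNr add0r addrC block_mxKdr.
Qed.

(** * Anisotropic forms of ranks 2 to 5 *)

Lemma fred_det_bound n (G : 'M[int]_n.+1) (B : nat) : G^T = G ->
    fred n.+1 (fun i j => (gram G i j)%:~R) ->
    (absz (\det G))%:R < (B%:R ^+ n.+1 * (3%:R / 4%:R) ^+ 'C(n.+1, 2) : rat) ->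
  `|G 0 0| < B%:Z.
Proof.
move=> symG sr ltB; rewrite -(ltr_int rat) intr_norm.
have syms j k : ((gram G j k)%:~R : rat) = (gram G k j)%:~R.
  by rewrite /gram -[in LHS]symG mxE.
have dE : \prod_(i < n.+1) gs (fun i j => (gram G i j)%:~R) i = (\det G)%:~R.
  rewrite -det_map_mx; symmetry; apply: det_fred sr => i j.
  by rewrite /gram !inord_val mxE.
have -> : G 0 0 = gram G 0 0.
  by rewrite /gram; congr (G _ _); apply: val_inj; rewrite /= inordK.
apply: (gs_lt (p := 0) syms sr (add0n _) (big_ord0 _ _ _ _) (lexx _)) => //.
by rewrite dE -intr_norm normr1 mul1r -abszE.
Qed.

Lemma gramE n (G : 'M[int]_n.+1) (i j : 'I_n.+1) : gram G i j = G i j.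
Proof. by rewrite /gram !inord_val. Qed.

Lemma det22 (R : comNzRingType) (M : 'M[R]_2) : \det M = M 0 0 * M 1 1 - M 0 1 * M 1 0.
Proof.
rewrite (expand_det_row _ 0) !big_ord_recl big_ord0 addr0 /cofactor !det_mx11 !mxE /=.
rewrite expr0 expr1 mul1r mulN1r mulrN.
by congr (M _ _ * M _ _ - M _ _ * M _ _); apply: val_inj.
Qed.

Lemma reduced2 (G : 'M[int]_2) : G^T = G -> anisoZ G ->
  exists2 U, U \in unitmx & let M := U *m G *m U^T in
    [/\ M 0 0 != 0, M 1 0 = M 0 1, `|M 0 1| * 2 <= `|M 0 0|,
        `|M 0 0| <= `|M 1 1| & \det G = M 0 0 * M 1 1 - M 0 1 ^+ 2].
Proof.
move=> symG aG; have [U Uu [sr _]] := reduced_form symG aG.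
exists U => //; set M := U *m G *m U^T in sr *.
have symM : M^T = M by apply: sym_congr.
have M10 : M 1 0 = M 0 1 by rewrite -[in LHS]symM mxE.
have [s0 /(_ 0%N isT) s01 /(_ 1%N isT) s11 _] := sr.
have g00 : gram M 0 0 = M 0 0 by exact: (gramE M 0 0).
have g01 : gram M 0 1 = M 0 1 by exact: (gramE M 0 1).
have g11 : gram M 1 1 = M 1 1 by exact: (gramE M 1 1).
rewrite g00 in s0 s01 s11; rewrite g01 in s01; rewrite g11 in s11.
split=> //.
- by rewrite intr_eq0 in s0.
- by move: s01; rewrite -!intr_norm -rmorphMn /= ler_int mulr2n; lia.

- by move: s11; rewrite -!intr_norm ler_int.
- by rewrite -(det_congr G Uu) det22 M10 expr2.
Qed.

Lemma diag13_2 (G U : 'M[int]_2) : U \in unitmx -> let M := U *m G *m U^T in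
  M 0 1 = 0 -> M 1 0 = 0 -> (`|M 0 0| = 1 \/ `|M 0 0| = 3) ->
  (`|M 1 1| = 1 \/ `|M 1 1| = 3) -> diag13 G.
Proof.
move=> Uu M M01 M10 M00 M11; exists U => //; split.
  apply/is_diag_mxP => -[[|[|//]] ?] [[|[|//]] ?] //= _.
    by rewrite -[RHS]M01; congr (_ _ _); apply: val_inj.
  by rewrite -[RHS]M10; congr (_ _ _); apply: val_inj.
move=> -[[|[|//]] i2].
  by rewrite (_ : Ordinal i2 = 0) //; apply: val_inj.
by rewrite (_ : Ordinal i2 = 1) //; apply: val_inj.
Qed.

Lemma norm13_factor (a b : int) : `|a * b| = 1 \/ `|a * b| = 3 -> `|a| = 1 \/ `|a| = 3.
Proof.
rewrite -!abszE abszM => ab13; have : (absz a %| 3)%N.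
  have [abE|abE] : (absz a * absz b = 1 \/ absz a * absz b = 3)%N by lia.
    by apply: (@dvdn_trans 1); rewrite // -abE dvdn_mulr.
  by rewrite -abE dvdn_mulr.
move=> d3; have := dvdn_leq (isT : (0 < 3)%N) d3; move: (absz a) d3 => m.
by case: m => [|[|[|[|m]]]] //; [left | right].
Qed.

Lemma indefinite2 (G N : 'M[int]_2) : dual_pair G N -> anisoZ G ->
  \det G < 0 -> `|\det G| <= 3 -> diag13 G.
Proof.
move=> dG aG det_lt0 det_le3; have [symG _ _ _] := dG.
have [k _ [kE _]] := det_dual_abs dG.
have det13 : `|\det G| = 1 \/ `|\det G| = 3.
  rewrite -abszE kE in det_le3 *.
  by case: k det_le3 {kE} => [|[|k]]; [left|right|]; rewrite // !expnS; lia.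
have [U Uu []] := reduced2 symG aG.
set a := _ 0 0; set c := _ 0 1; set b := _ 1 1 => a0 M10 le1 le2 detE.
have le_ab : 4 * c ^+ 2 <= `|a * b|.
  by rewrite normrM -real_normK ?num_real // expr2; nia.
(* Since |ab| >= 4c^2 and ab - c^2 < 0, the product ab is negative and ab - c^2 <= -5c^2, which is
   below -3 unless c = 0. *)
have c0 : c = 0.
  have : c ^+ 2 <= 0 by rewrite detE in det_lt0 det_le3; lia.
  by rewrite le_eqVlt ltNge sqr_ge0 orbF sqrf_eq0 => /eqP.
rewrite c0 expr0n subr0 in detE.
rewrite detE in det13.
apply: (diag13_2 Uu); rewrite -/a -/b -/c ?M10 //; first exact: norm13_factor det13.
by apply: (@norm13_factor b a); rewrite mulrC.
Qed.

Lemma qf_delta n (G : 'M[int]_n) i j : qf G (delta_mx 0 i) (delta_mx 0 j) = G i j.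
Proof. by rewrite /qf -rowE trmx_delta -colE !mxE. Qed.

Lemma diag_entry_pos n (G : 'M[int]_n) i : posdef G -> 0 < G i i.
Proof.
move=> /(_ (delta_mx 0 i)); rewrite /qf -rowE trmx_delta -colE !mxE; apply.
by apply/eqP => /matrixP /(_ 0 i) /eqP; rewrite !mxE !eqxx.
Qed.

(** The second alternative is the hexagonal form A_2, with reduced Gram entries 2, 2 and 1 or -1: it
    has no vector of norm 1 and is not diagonalizable. *)
Lemma posdef2 (G N : 'M[int]_2) : dual_pair G N -> posdef G -> `|\det G| <= 3 ->
  diag13 G \/ \det G = 3 /\
    exists2 U, U \in unitmx & (U *m G *m U^T) 0 0 = 2.
Proof.
move=> dG pG det_le3; have [symG _ _ _] := dG.
have [k _ [kE _]] := det_dual_abs dG.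
have det13 : `|\det G| = 1 \/ `|\det G| = 3.
  rewrite -abszE kE in det_le3 *.
  by case: k det_le3 {kE} => [|[|k]]; [left|right|]; rewrite // !expnS; lia.
have [U Uu []] := reduced2 symG (posdef_aniso pG).
have pM := posdef_congr Uu pG; have := diag_entry_pos 0 pM; have := diag_entry_pos 1 pM.
set a := _ 0 0; set c := _ 0 1; set b := _ 1 1 => b0 a0 _ M10 le1 le2 detE.
have [c0|c0] := eqVneq c 0.
  rewrite c0 expr0n subr0 in detE; left.
  rewrite detE in det13.
  apply: (diag13_2 Uu); rewrite -/a -/b -/c ?M10 //; first exact: norm13_factor det13.
  by apply: (@norm13_factor b a); rewrite mulrC.
have a2 : a = 2 by rewrite detE expr2 in det13; nia.
have b2 : b = 2 by rewrite detE expr2 a2 in det13 *; nia.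
right; split; last by exists U.
by rewrite detE expr2 a2 b2 in det13 *; nia.
Qed.

(** In a basis that starts with an isotropic vector the determinant is -c^2, and 3 is not a
    square. *)
Lemma anisoZ_det_neg3 (G : 'M[int]_2) : G^T = G -> \det G = -3 -> anisoZ G.
Proof.
move=> symG detG x x0; apply/negP => /eqP qx0; have [d [U Uu xE]] := row_complete x.
have d0 : d != 0 by apply: contraNneq x0 => d0; rewrite xE d0 scale0r.
have symM := sym_congr U symG.
move: qx0; rewrite xE qf_scale -qf_row => /eqP; rewrite !mulf_eq0 (negPf d0) /= => /eqP M00.
have := det22 (U *m G *m U^T); rewrite det_congr // detG M00 mul0r add0r.
have -> : (U *m G *m U^T) 1 0 = (U *m G *m U^T) 0 1 by rewrite -[in LHS]symM mxE.
set c := _ 0 1 => cc; have {}cc : c * c = 3 by lia.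
have [c2|c1] : `|c| <= 1 \/ 2 <= `|c| by lia.
  by nia.
by nia.
Qed.

Lemma bcons_unit n (U : 'M[int]_n) : U \in unitmx -> bcons 1 U \in unitmx.
Proof. by rewrite !unitmxE det_bcons mul1r. Qed.

Lemma sym_bcons n a (H : 'M[int]_n) : H^T = H -> (bcons a H)^T = bcons a H.
Proof.
move=> symH; suff : (block_mx (a%:M : 'M_1) 0 0 H)^T = block_mx a%:M 0 0 H by [].
by rewrite tr_block_mx !trmx0 tr_scalar_mx symH.
Qed.

Lemma dual_pair_bconsl n a b (H N : 'M[int]_n) :
  a * b = 3 -> dual_pair H N -> dual_pair (bcons a H) (bcons b N).
Proof.
move=> ab [symH _ HN _]; apply: dual_pairP; first exact: sym_bcons.
suff : block_mx (a%:M : 'M_1) 0 0 H *m block_mx b%:M 0 0 N = 3%:M by [].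
by rewrite mulmx_block !mul0mx !mulmx0 !addr0 add0r HN scalar_mx_block -scalar_mxM ab.
Qed.

(** If [G] is A_2, a vector of norm 2 plus the one of norm -1 has norm 1, and its complement is an
    indefinite plane of determinant -3, already treated. *)
Lemma neg_bcons2 (G N : 'M[int]_2) : dual_pair G N -> posdef G -> diag13 (bcons (-1) G).
Proof.
move=> dG pG; have [symG _ _ _] := dG.
have [det_le3|det_gt3] := leP `|\det G| 3.
  have [dgG|[det3 [U Uu M00]]] := posdef2 dG pG det_le3.
    by apply: diag13_bcons => //; left.
  have dM := dual_pair_congr Uu dG; set M := U *m G *m U^T in M00 dM.
  apply: (diag13_congr (bcons_unit Uu)); rewrite bcons_congr -/M.
  have symM : (bcons (-1) M)^T = bcons (-1) M by apply: sym_bcons; case: dM.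
  have [|||V Vu [_ [H HE]]] := @split_vector _ (bcons (-1) M) 1 (vcons 1 (delta_mx 0 0)).
  - exact: symM.
  - by [].
  - by rewrite qf_bcons qf_delta M00.
  apply: (diag13_congr Vu); rewrite HE; apply: diag13_bcons; first by left.
  have := dual_pair_congr Vu (dual_pair_bconsl (erefl : (-1) * (-3) = 3 :> int) dM).
  rewrite HE => /dual_pair_bcons[H' dH _].
  have detH : \det H = -3.
    by rewrite -(mul1r (\det H)) -det_bcons -HE det_congr // det_bcons det_congr // det3.
  apply: (indefinite2 dH); rewrite ?detH //.
  by apply: anisoZ_det_neg3 => //; case: dH.
(* The remaining determinant is 9, so the dual has determinant 1 and cannot be A_2. *)
have [k k2 [kE kE']] := det_dual_abs dG.
have detN : `|\det N| = 1.
  rewrite -!abszE kE' in det_gt3 *; rewrite kE in det_gt3.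
  by case: k k2 det_gt3 {kE kE'} => [|[|[|k]]].
apply: diag13_bcons; first by left.
apply: (diag13_dual dG).
have [|//|[detN3 _]] := posdef2 (dual_pair_sym dG) (posdef_dual dG pG).
  by rewrite detN.
by rewrite detN3 in detN.
Qed.

Lemma qf_inj n (A B : 'M[int]_n) : (forall x y, qf A x y = qf B x y) -> A = B.
Proof. by move=> AB; apply/matrixP => i j; rewrite -!qf_delta AB. Qed.

Lemma vcons0E n a (x : 'rV[int]_n) : vcons a x 0 0 = a.
Proof.
have E : 0 = @lshift 1 n 0 :> 'I_n.+1 by apply: val_inj.
rewrite [X in vcons _ _ _ X]E.
suff : row_mx (a%:M : 'M_1) x 0 (lshift n 0) = a by [].
by rewrite row_mxEl mxE eqxx.
Qed.

Lemma vconsSE n a (x : 'rV[int]_n) j : vcons a x 0 (lift 0 j) = x 0 j.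
Proof.
have -> : lift 0 j = @rshift 1 n j :> 'I_n.+1 by apply: val_inj.
suff : row_mx (a%:M : 'M_1) x 0 (rshift 1 j) = x 0 j by [].
by rewrite row_mxEr.
Qed.

Lemma bcons_swap_mx n a b (K : 'M[int]_n) : exists2 U, U \in unitmx &
  U *m bcons a (bcons b K) *m U^T = bcons b (bcons a K).
Proof.
pose i1 : 'I_n.+2 := lift 0 0; pose P := perm_mx (tperm 0 i1) : 'M[int]_n.+2.
have swapP s t (z : 'rV[int]_n) : vcons s (vcons t z) *m P = vcons t (vcons s z).
  rewrite /P -[tperm _ _]invgK tpermV -col_permE; apply/rowP => j; rewrite mxE.
  have [j' ->|->] := unliftP 0 j; last by rewrite tpermL vconsSE !vcons0E.
  rewrite vconsSE; have [k ->|->] := unliftP 0 j'; last by rewrite tpermR !vcons0E.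
  by rewrite tpermD ?vconsSE // -val_eqE.
exists P; first exact: unitmx_perm.
apply: qf_inj => x y; rewrite qf_congr.
have [s [x' ->]] := vconsP x; have [t [x'' ->]] := vconsP x'.
have [u [y' ->]] := vconsP y; have [v [y'' ->]] := vconsP y'.
by rewrite !swapP !qf_bcons addrCA.
Qed.

Lemma diag13_swap n a b (K : 'M[int]_n) :
  diag13 (bcons a (bcons b K)) -> diag13 (bcons b (bcons a K)).
Proof.
by have [U Uu <-] := bcons_swap_mx b a K; apply: diag13_congr.
Qed.

Lemma norm_det_le (n : nat) (G N : 'M[int]_n) (m : nat) : dual_pair G N ->
  (n <= m.*2.+1)%N -> `|\det G| <= 3 ^+ m \/ `|\det N| <= 3 ^+ m.
Proof.
move=> dG le_n; have [k le_kn [kE kE']] := det_dual_abs dG.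
have -> : 3 ^+ m = (3 ^ m)%N%:Z by rewrite -natz natrX.
rewrite -!abszE kE kE' !lez_nat !leq_exp2l //; lia.
Qed.

Lemma first_norm_lt n (G : 'M[int]_n.+1) (B d : nat) : G^T = G ->
    fred n.+1 (fun i j => (gram G i j)%:~R) -> `|\det G| <= d%:Z ->
    (d%:R < (B%:R ^+ n.+1 * (3%:R / 4%:R) ^+ 'C(n.+1, 2) : rat)) ->
  `|G 0 0| < B%:Z.
Proof.
move=> symG sr le_d ltB; apply: (fred_det_bound symG sr); apply: le_lt_trans ltB.
by rewrite ler_nat -lez_nat abszE.
Qed.

Lemma fred_pivot_neq0 n (G : 'M[int]_n.+1) :
  fred n.+1 (fun i j => (gram G i j)%:~R) -> G 0 0 != 0.
Proof. by case; rewrite intr_eq0 (gramE G 0 0). Qed.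

(** One of [G] and [N] has determinant at most 3, hence splits off a 1; a summand 1 of [N] is a
    summand 3 of [G]. *)
Lemma posdef_split3 (G N : 'M[int]_3) : dual_pair G N -> posdef G ->
  exists2 U, U \in unitmx & exists d K K',
    [/\ U *m G *m U^T = bcons d K, `|d| = 1 \/ `|d| = 3, dual_pair K K' & posdef K].
Proof.
have split1 (A B : 'M[int]_3) : dual_pair A B -> posdef A -> `|\det A| <= 3 ->
    exists2 U, U \in unitmx & exists K, U *m A *m U^T = bcons 1 K.
  move=> dA pA det_le3; have [symA _ _ _] := dA.
  have [U Uu [sr _]] := reduced_form symA (posdef_aniso pA); exists U => //.
  have pM := posdef_congr Uu pA; have M0 : 0 < (U *m A *m U^T) 0 0 := diag_entry_pos 0 pM.
  have symM := sym_congr U symA.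
  have M2 : `|(U *m A *m U^T) 0 0| < 2%N.
    have lt3 : 3%:R < (2%:R ^+ 3 * (3%:R / 4%:R) ^+ 3 : rat) := isT.
    by apply: (first_norm_lt (d := 3) symM sr _ lt3); rewrite det_congr.
  have M1 : (U *m A *m U^T) 0 0 = 1 by move: M0 M2; set z := _ 0 0; lia.
  have [|K ->] := reduced_split symM sr; first by rewrite M1.
  by exists K; rewrite M1.
move=> dG pG; have [le3|le3] := norm_det_le (m := 1) dG isT.
  have [U Uu [K E]] := split1 _ _ dG pG le3; exists U => //.
  have := dual_pair_congr Uu dG; rewrite E => /dual_pair_bcons[K' dK _].
  exists 1, K, K'; split=> //; first by left.
  by apply: (@posdef_bcons _ 1); rewrite -E; apply: posdef_congr.
have dN := dual_pair_sym dG.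
have [U Uu [K E]] := split1 _ _ dN (posdef_dual dG pG) le3.
have := dual_pair_congr Uu dN; rewrite E => /dual_pair_bcons[K' dK [b [b3 KE]]].
have U'u : (invmx U)^T \in unitmx by rewrite unitmx_tr unitmx_inv.
exists (invmx U)^T => //; exists b, K', K.
have E' : (invmx U)^T *m G *m (invmx U)^T^T = bcons b K' by rewrite trmxK.
split=> //; first by right; rewrite mul1r in b3; rewrite b3.
  exact: dual_pair_sym.
by apply: (@posdef_bcons _ b); rewrite -E'; apply: posdef_congr.
Qed.

Lemma neg_bcons3 (G N : 'M[int]_3) : dual_pair G N -> posdef G -> diag13 (bcons (-1) G).
Proof.
move=> dG pG; have [U Uu [d [K [K' [E d13 dK pK]]]]] := posdef_split3 dG pG.
apply: (diag13_congr (bcons_unit Uu)); rewrite bcons_congr E.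
by apply: diag13_swap; apply: diag13_bcons d13 _; apply: neg_bcons2 dK pK.
Qed.

(** The reverse Cauchy-Schwarz inequality against the vector of norm -1 makes [K] nonnegative. A
    nonnegative form vanishes only on its radical, which is zero because [K] has a dual. *)
Lemma hyperbolic_neg_posdef n (K K' : 'M[int]_n) : dual_pair K K' ->
  hyperbolic (bcons (-1) K) -> posdef K.
Proof.
move=> dK hG; have [symK _ _ _] := dK.
have K_ge0 x : 0 <= qf K x x.
  have := hG (vcons 1 0) (vcons 0 x); rewrite !qf_bcons /qf !mul0mx mxE.
  by rewrite -!/(qf _ _ _) => /(_ isT); set z := qf _ _ _; rewrite expr2; lia.
move=> x x0; rewrite lt_def K_ge0 andbT; apply/eqP => qx.
have xK0 : x *m K = 0.
  apply/rowP => i; rewrite [RHS]mxE.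
  have -> : (x *m K) 0 i = qf K x (delta_mx 0 i) by rewrite /qf trmx_delta -colE [RHS]mxE.
  set b := qf _ _ _.
  have bE t : 0 <= K i i + 2 * t * b.
    have := K_ge0 (delta_mx 0 i + t *: x); rewrite qfDl !qfDr !qfZl !qfZr qx qf_delta.
    by rewrite (qf_sym (delta_mx 0 i)) // -/b; lia.
  (* For nonzero b this multiplier gives K_ii - 2 (K_ii + 1) b^2 < 0, against [bE]. *)
  have := bE 0; have := bE (- (K i i + 1) * b); move: (K i i) => k h1 h2.
  apply/eqP; apply: contraT => b0; have : 1 <= b * b by nia.
  nia.
by rewrite (dual_pair_inj dK xK0) eqxx in x0.
Qed.

Lemma det_dual_lt0 n (G N : 'M[int]_n) : dual_pair G N -> \det G < 0 -> \det N < 0.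
Proof.
move=> /det_dual dE det_lt0; have : 0 < \det G * \det N by rewrite dE exprn_gt0.
by rewrite nmulr_rgt0.
Qed.

Lemma norm1_cases (a : int) : `|a| = 1 -> a = 1 \/ a = -1.
Proof. lia. Qed.

(** Here 2^3 (3/4)^3 = 27/8 exceeds 3, so the first vector of a reduced basis has norm 1 or -1. *)
Lemma indefinite3 (G N : 'M[int]_3) : dual_pair G N -> anisoZ G -> hyperbolic G ->
  \det G < 0 -> diag13 G.
Proof.
have core (A B : 'M[int]_3) : dual_pair A B -> anisoZ A -> hyperbolic A ->
    \det A < 0 -> `|\det A| <= 3 -> diag13 A.
  move=> dA aA hA det_lt0 det_le3; have [symA _ _ _] := dA.
  have [U Uu [sr _]] := reduced_form symA aA.
  have symM := sym_congr U symA; have M0 := fred_pivot_neq0 sr.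
  have M2 : `|(U *m A *m U^T) 0 0| < 2%N.
    have lt3 : 3%:R < (2%:R ^+ 3 * (3%:R / 4%:R) ^+ 3 : rat) := isT.
    by apply: (first_norm_lt (d := 3) symM sr _ lt3); rewrite det_congr.
  have Mn1 : `|(U *m A *m U^T) 0 0| = 1 by move: M0 M2; set z := _ 0 0; lia.
  have [K E] := reduced_split symM sr Mn1.
  apply: (diag13_congr Uu).
  have := dual_pair_congr Uu dA; have := anisoZ_congr Uu aA; have := @hyperbolic_congr _ _ U hA.
  have := det_congr A Uu; rewrite E => detE hM aM /dual_pair_bcons[K' dK _].
  have [M1|M1] := norm1_cases Mn1.
    rewrite M1 in hM aM detE *; rewrite det_bcons mul1r in detE.
    apply: diag13_bcons; first by left.
    by apply: (indefinite2 dK); rewrite ?detE //; apply: anisoZ_bcons aM.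
  rewrite M1 in hM aM detE *.
  exact: neg_bcons2 dK (hyperbolic_neg_posdef dK hM).
move=> dG aG hG det_lt0; have [le3|le3] := norm_det_le (m := 1) dG isT.
  exact: core dG aG hG det_lt0 le3.
have dN := dual_pair_sym dG; apply: (diag13_dual dG).
by apply: (core _ _ dN (anisoZ_dual dG aG) (hyperbolic_dual dG hG) (det_dual_lt0 dG det_lt0) le3).
Qed.

Lemma unit_norm_split n (G N : 'M[int]_n.+1) : n = 3 \/ n = 4 -> dual_pair G N ->
    anisoZ G -> hyperbolic G -> \det G < 0 -> `|\det G| <= 9 ->
  exists2 U, U \in unitmx & exists e K, (e = 1 \/ e = -1) /\ U *m G *m U^T = bcons e K.
Proof.
move=> n34 dG aG hG det_lt0 det_le9; have [symG _ _ _] := dG.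
have [U Uu [sr Umin]] := reduced_form symG aG; exists U => //.
have symM := sym_congr U symG; have M0 := fred_pivot_neq0 sr.
set M := U *m G *m U^T in sr Umin symM M0 *.
have [M1|M_neq1] := eqVneq `|M 0 0| 1.
  have [K ->] := reduced_split symM sr M1.
  by exists (M 0 0), K; split=> //; apply: norm1_cases.
have [k _ [kE _]] := det_dual_abs dG.
exfalso; apply: (@no_small_form n M (- \det G)) => //.
- have : absz (\det G) = 1%N \/ absz (\det G) = 3%N \/ absz (\det G) = 9%N.
    have le_k2 : (k <= 2)%N by rewrite -(@leq_exp2l 3) // -kE -lez_nat abszE.
    by rewrite kE; case: k le_k2 {kE} => [|[|[|]]] // _; [left | right; left | right; right].
  by move: det_lt0; move: (\det G) => d; lia.
- by rewrite opprK det_congr.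
- move=> y y0; have := Umin _ (mulmx_unit_neq0 Uu y0); rewrite -qf_congr -/M.
  by move: M0 M_neq1; move: (qf M y y) => q; move: (M _ _) => a; lia.
- exact: hyperbolic_congr.
Qed.

Lemma indefinite4 (G N : 'M[int]_4) : dual_pair G N -> anisoZ G -> hyperbolic G ->
  \det G < 0 -> `|\det G| <= 9 -> diag13 G.
Proof.
move=> dG aG hG det_lt0 det_le9.
have [|U Uu [e [K [e1 E]]]] := unit_norm_split _ dG aG hG det_lt0 det_le9; first by left.
apply: (diag13_congr Uu).
have := dual_pair_congr Uu dG; have := anisoZ_congr Uu aG; have := @hyperbolic_congr _ _ U hG.
have := det_congr G Uu; rewrite E => detE hM aM /dual_pair_bcons[K' dK _].
case: e1 E detE hM aM => -> E detE hM aM.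
  rewrite det_bcons mul1r in detE; apply: diag13_bcons; first by left.
  apply: (indefinite3 dK); rewrite ?detE //; first exact: anisoZ_bcons aM.
  exact: hyperbolic_bcons hM.
exact: neg_bcons3 dK (hyperbolic_neg_posdef dK hM).
Qed.

Lemma split_one4 (G N : 'M[int]_5) x : dual_pair G N -> anisoZ G -> hyperbolic G ->
  \det G < 0 -> `|\det G| <= 9 -> qf G x x = 1 -> diag13 G.
Proof.
move=> dG aG hG det_lt0 det_le9 qx; have [symG _ _ _] := dG.
have [U Uu [_ [K E]]] := split_vector symG (mulr1 1) qx.
apply: (diag13_congr Uu).
have := dual_pair_congr Uu dG; have := anisoZ_congr Uu aG; have := @hyperbolic_congr _ _ U hG.
have := det_congr G Uu; rewrite E => detE hM aM /dual_pair_bcons[K' dK _].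
rewrite det_bcons mul1r in detE; apply: diag13_bcons; first by left.
apply: (indefinite4 dK); rewrite ?detE //; first exact: anisoZ_bcons aM.
exact: hyperbolic_bcons hM.
Qed.

(** If -1 splits off, the complement is definite of rank 4, beyond the reach of [neg_bcons3], so a
    vector of norm 1 is sought. As 3^4 (3/4)^6 > 9, a shortest vector of the complement has norm 1,
    or norm 2 and then norm 1 after adding the vector of norm -1. *)
Lemma anisotropic5 (G N : 'M[int]_5) : dual_pair G N -> anisoZ G -> hyperbolic G ->
  \det G < 0 -> diag13 G.
Proof.
have core (A B : 'M[int]_5) : dual_pair A B -> anisoZ A -> hyperbolic A ->
    \det A < 0 -> `|\det A| <= 9 -> diag13 A.
  move=> dA aA hA det_lt0 det_le9.
  have [|U Uu [e [K [e1 E]]]] := unit_norm_split _ dA aA hA det_lt0 det_le9; first by right.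
  have := dual_pair_congr Uu dA; have hM := @hyperbolic_congr _ _ U hA.
  have := det_congr A Uu; rewrite E in hM *; move=> detE /dual_pair_bcons[K' dK _].
  case: e1 => e1; rewrite e1 in E detE hM.
    apply: (@split_one4 _ _ (vcons 1 0 *m U) dA) => //.
    by rewrite -qf_congr E qf_bcons /qf !mul0mx mxE.
  have pK := hyperbolic_neg_posdef dK hM; have [symK _ _ _] := dK.
  have [V Vu [sr _]] := reduced_form symK (posdef_aniso pK).
  have symV := sym_congr V symK.
  have V0 : 0 < (V *m K *m V^T) 0 0 := diag_entry_pos 0 (posdef_congr Vu pK).
  have V3 : `|(V *m K *m V^T) 0 0| < 3%N.
    apply: (first_norm_lt (d := 9) symV sr _ (isT : 9%:R < (3%:R ^+ 4 * (3%:R / 4%:R) ^+ 6 : rat))).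
    by rewrite det_congr //; move: det_le9; rewrite -detE det_bcons mulN1r normrN.
  pose y : 'rV_4 := delta_mx 0 0 *m V.
  have qy : qf K y y = (V *m K *m V^T) 0 0 by rewrite -qf_congr qf_delta.
  have [V1|V2] : (V *m K *m V^T) 0 0 = 1 \/ (V *m K *m V^T) 0 0 = 2.
    by move: V0 V3; set z := _ 0 0; lia.
    apply: (@split_one4 _ _ (vcons 0 y *m U) dA) => //.
    by rewrite -qf_congr E qf_bcons qy V1.
  apply: (@split_one4 _ _ (vcons 1 y *m U) dA) => //.
  by rewrite -qf_congr E qf_bcons qy V2.
move=> dG aG hG det_lt0; have [le9|le9] := norm_det_le (m := 2) dG isT.
  exact: core dG aG hG det_lt0 le9.
have dN := dual_pair_sym dG; apply: (diag13_dual dG).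
by apply: (core _ _ dN (anisoZ_dual dG aG) (hyperbolic_dual dG hG) (det_dual_lt0 dG det_lt0) le9).
Qed.

(** * Isotropic forms of rank 5 *)

Lemma skew_odd_det n (A : 'M[int]_n) : odd n -> A^T = - A -> \det A = 0.
Proof.
move=> oddn skA; have := det_tr A; rewrite skA -scaleN1r detZ -signr_odd oddn expr1 mulN1r.
by move: (\det A) => d; lia.
Qed.

(* Otherwise G would be skew-symmetric modulo 2 and its determinant even. *)
Lemma odd_form_diag n (G N : 'M[int]_n) : odd n -> dual_pair G N ->
  exists i, exists k, G i i = 2 * k + 1.
Proof.
move=> oddn dG; have [symG _ _ _] := dG; apply: NNPP => noodd.
have evenG i : (G i i)%:~R = 0 :> 'F_2.
  have [k [->|Gii]] : exists k, G i i = 2 * k \/ G i i = 2 * k + 1.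
    by exists (G i i %/ 2)%Z; lia.
    by rewrite rmorphM /= (_ : 2%:~R = 0 :> 'F_2) ?mul0r //; apply: val_inj.
  by case: noodd; exists i, k.
pose A := \matrix_(i, j) (if (i < j)%N then G i j else if (j < i)%N then - G i j else 0).
have skA : A^T = - A.
  have symij i j : G i j = G j i by rewrite -[in LHS]symG mxE.
  apply/matrixP => i j; rewrite !mxE (symij j i).
  by case: ltngtP => _; rewrite ?opprK ?oppr0.
have GA : map_mx (intr : int -> 'F_2) G = map_mx intr A.
  apply/matrixP => i j; rewrite !mxE; case: ltngtP => // [_|/val_inj ->].
    by rewrite rmorphN /= oppr_pchar2 // pchar_Fp.
  exact: evenG.
have /eqP := congr1 determinant GA; rewrite !det_map_mx (skew_odd_det oddn skA) rmorph0.
have [k _ [kE _]] := det_dual_abs dG.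
suff /negPf -> : (\det G)%:~R != 0 :> 'F_2 by [].
have E : ((3 ^ k)%N%:Z)%:~R = 1 :> 'F_2.
  rewrite -[LHS]/((3 ^ k)%N%:R) natrX (_ : 3%:R = 1) ?expr1n //; exact: val_inj.
have [->|->] : \det G = (3 ^ k)%N%:Z \/ \det G = - (3 ^ k)%N%:Z by lia.
  by rewrite E oner_eq0.
by rewrite rmorphN /= E oppr_eq0 oner_eq0.
Qed.

Lemma dual_vector n (U : 'M[int]_n.+1) : U \in unitmx -> exists f : 'rV_n.+1, row 0 U *m f^T = 1%:M.
Proof.
move=> Uu; exists (delta_mx 0 0 *m (invmx U)^T).
rewrite trmx_mul trmxK rowE mulmxA mulmxK // trmx_delta mul_delta_mx.
by apply/matrixP => i j; rewrite !mxE !ord1.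
Qed.

Definition hyperbolic_pair n (G : 'M[int]_n) (e f : 'rV_n) := qf G e e = 0 /\ qf G e f = 1.

(** Let e be primitive isotropic and e G = c r with r primitive. From c (r N) = 3 e and primitivity
    of e, c divides 3. If c is a unit, e pairs to 1 with some f under [G]; otherwise r N = e or -e,
    and r is the isotropic half of a pair for [N]. *)
Lemma isotropic_pair n (G N : 'M[int]_n.+1) x : dual_pair G N -> x != 0 -> qf G x x = 0 ->
  (exists e f, hyperbolic_pair G e f) \/ (exists e f, hyperbolic_pair N e f).
Proof.
move=> dG x0 qx; have [symG symN GN NG] := dG; have [d [U Uu xE]] := row_complete x.
have d0 : d != 0 by apply: contraNneq x0 => d0; rewrite xE d0 scale0r.
set e := row 0 U in xE; have [f1 ef1] := dual_vector Uu; rewrite -/e in ef1.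
have qe : qf G e e = 0.
  by move/eqP: qx; rewrite xE qf_scale !mulf_eq0 (negPf d0) => /eqP.
have [c [V Vu yE]] := row_complete (e *m G); set r := row 0 V in yE.
have [f0 rf0] := dual_vector Vu; rewrite -/r in rf0.
have eN : c *: (r *m N) = 3 *: e by rewrite scalemxAl -yE -mulmxA GN mul_mx_scalar.
have c3 : c * (r *m N *m f1^T) 0 0 = 3.
  have := congr1 (fun v => (v *m f1^T) 0 0) eN.
  by rewrite -!scalemxAl ef1 [LHS]mxE => ->; rewrite !mxE mulr1.
have [c1|c_3] : `|c| = 1 \/ `|c| = 3.
    by apply: (norm13_factor (b := (r *m N *m f1^T) 0 0)); right; rewrite c3.
  left; exists e, (c *: f0); split=> //; rewrite qfZr /qf yE -scalemxAl rf0 !mxE.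
  by case: (norm1_cases c1) => ->.
right; exists r.
have [s ss cE] : exists2 s, s * s = 1 & c = 3 * s.
  have [->|->] : c = 3 \/ c = -3 by lia.
    by exists 1.
  by exists (-1).
have rNE : r *m N = s *: e.
  have /eqP : 3 *: (s *: (r *m N)) = 3 *: e by rewrite scalerA -cE.
  rewrite -subr_eq0 -scalerBr => /eqP /scalemx_inj -/(_ isT) /eqP.
  by rewrite subr_eq0 => /eqP <-; rewrite scalerA ss scale1r.
exists (s *: f1); split; last first.
  by rewrite qfZr /qf rNE -scalemxAl ef1 !mxE mulr1 ss.
rewrite /qf rNE -scalemxAl mxE; suff -> : (e *m r^T) 0 0 = 0 by rewrite mulr0.
have : c * (e *m r^T) 0 0 = 0.
  rewrite -qe /qf yE -scalemxAl [RHS]mxE; congr (_ * _).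
  by rewrite -[e in LHS]trmxK -trmx_mul mxE.
by move/eqP; rewrite mulf_eq0 => /orP[/eqP c0|/eqP //]; rewrite c0 in c_3.
Qed.

(** A hyperbolic plane may be even, hence not diagonalizable, so a vector of odd norm is used to
    change [f]. Then e and f' span an odd plane, with orthogonal vectors u and g of norms 1 and -1;
    the complement of these is definite of rank 3. *)
Lemma hyperbolic_pair_split (G N : 'M[int]_5) e f : dual_pair G N -> hyperbolic G ->
  hyperbolic_pair G e f -> diag13 G.
Proof.
move=> dG hG [qe ef]; have [symG _ _ _] := dG.
have [i [k Gii]] := odd_form_diag (isT : odd 5) dG.
have [f' ef' [l qf']] : exists2 f', qf G e f' = 1 & exists l, qf G f' f' = 2 * l + 1.
  have [l [qfE|qfE]] : exists l, qf G f f = 2 * l \/ qf G f f = 2 * l + 1.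
    by exists (qf G f f %/ 2)%Z; lia.
  pose z : 'rV[int]_5 := delta_mx 0 i; pose m := qf G e z.
    (* The coefficient restores product 1 with [e]; the norm has the parity of that of [z], since
       [f] has even norm. *)
    exists ((1 - m) *: f + z); first by rewrite qfDr qfZr ef -/m; lia.
    rewrite qfDl !qfDr !qfZl !qfZr qfE qf_delta Gii (qf_sym z f) //.
    by exists ((1 - m) * (1 - m) * l + (1 - m) * qf G f z + k); lia.
  by exists f => //; exists l.
pose u := f' - l *: e.
have eu : qf G e u = 1 by rewrite /u -scaleNr qfDr qfZr ef' qe mulr0 addr0.
have qu : qf G u u = 1.
  by rewrite /u -scaleNr qfDl !qfDr !qfZl !qfZr qe ef' (qf_sym f' e) // ef' qf'; lia.
pose g := u - e.
have ug : qf G u g = 0 by rewrite /g -scaleN1r qfDr qfZr qu (qf_sym u e) // eu.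
have qg : qf G g g = -1.
  by rewrite {1}/g -scaleN1r qfDl qfZl ug /g -scaleN1r qfDr qfZr eu qe; lia.
have [U Uu [uE [H E]]] := split_vector symG (mulr1 1) qu.
apply: (diag13_congr Uu); rewrite E; apply: diag13_bcons; first by left.
have := dual_pair_congr Uu dG; have hM := @hyperbolic_congr _ _ U hG.
rewrite E in hM * => /dual_pair_bcons[H' dH _]; have [symH _ _ _] := dH.
have [a [h ghE]] := vconsP (g *m invmx U).
have gE : g = vcons a h *m U by rewrite -ghE mulmxKV.
have a0 : a = 0.
  move: ug; rewrite -uE gE -qf_congr E qf_bcons /qf !mul0mx mxE; lia.
have qh : qf H h h = -1.
  by move: qg; rewrite gE a0 -qf_congr E qf_bcons; lia.
have [V Vu [_ [K KE]]] := split_vector symH (erefl : (-1) * (-1) = 1 :> int) qh.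
apply: (diag13_congr Vu); rewrite KE.
have := dual_pair_congr Vu dH; rewrite KE => /dual_pair_bcons[K' dK _].
apply: (neg_bcons3 dK); apply: (hyperbolic_neg_posdef dK).
by rewrite -KE; apply/hyperbolic_congr/hyperbolic_bcons/hM.
Qed.

Lemma hyperbolic_diag13 (G N : 'M[int]_5) : dual_pair G N -> hyperbolic G ->
  \det G < 0 -> diag13 G.
Proof.
move=> dG hG det_lt0.
have [[x x0 qx]|aG] := classic (exists2 x, x != 0 & qf G x x = 0).
  have [[e [f ef]]|[e [f ef]]] := isotropic_pair dG x0 qx.
    exact: hyperbolic_pair_split dG hG ef.
  apply: (diag13_dual dG); have dN := dual_pair_sym dG.
  exact: hyperbolic_pair_split dN (hyperbolic_dual dG hG) ef.
apply: (anisotropic5 dG) => // x x0; apply/eqP => qx.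
by case: aG; exists x.
Qed.

(** * Eisenstein integers *)

(** Only the additive group of the product type is copied, since its own ring multiplication is
    componentwise and not [emul]. *)
Definition eisenstein := eis.
HB.instance Definition _ := GRing.Zmodule.copy eisenstein (int * int)%type.

Definition eone : eisenstein := (1, 0).

Lemma eis_mulA : associative (emul : eisenstein -> eisenstein -> eisenstein).
Proof. by case=> [a b] [c d] [e f]; congr pair; rewrite /=; ring. Qed.
Lemma eis_mulC : commutative (emul : eisenstein -> eisenstein -> eisenstein).
Proof. by case=> [a b] [c d]; congr pair; rewrite /=; ring. Qed.
Lemma eis_mul1 : left_id eone (emul : eisenstein -> eisenstein -> eisenstein).
Proof. by case=> [a b]; congr pair; rewrite /=; ring. Qed.
Lemma eis_mulD : left_distributive (emul : eisenstein -> eisenstein -> eisenstein) +%R.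
Proof. by case=> [a b] [c d] [e f]; congr pair; rewrite /=; ring. Qed.
Lemma eis_one_neq0 : eone != 0.
Proof. by []. Qed.

HB.instance Definition _ := GRing.Zmodule_isComNzRing.Build eisenstein
  eis_mulA eis_mulC eis_mul1 eis_mulD eis_one_neq0.

Definition conjE (x : eisenstein) : eisenstein := econj x.

Lemma conjE_additive : zmod_morphism conjE.
Proof. by case=> [a b] [c d]; congr pair; rewrite /=; ring. Qed.
Lemma conjE_multiplicative : monoid_morphism conjE.
Proof. by split=> [|[a b] [c d]]; congr pair; rewrite /=; ring. Qed.
HB.instance Definition _ := GRing.isZmodMorphism.Build _ _ conjE conjE_additive.
HB.instance Definition _ := GRing.isMonoidMorphism.Build _ _ conjE conjE_multiplicative.

Lemma conjEK : involutive conjE.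
Proof. by case=> [a b]; congr pair; rewrite /=; ring. Qed.

Definition normE (x : eisenstein) : int := x.1 ^+ 2 - x.1 * x.2 + x.2 ^+ 2.

Lemma eis_intrE (n : int) : n%:~R = (n, 0) :> eisenstein.
Proof.
elim/int_rec: n => [|n IHn|n IHn] //.
  by rewrite -addn1 PoszD rmorphD /= IHn.
by rewrite -addn1 PoszD opprD rmorphD /= IHn.
Qed.

Lemma normE_conj x : x * conjE x = (normE x)%:~R.
Proof. by rewrite eis_intrE; case: x => a b; congr pair; rewrite /normE /=; ring. Qed.

Lemma normE_eq0 x : normE x = 0 -> x = 0.
Proof.
case: x => a b; rewrite /normE /= => ab0; have : a = 0 /\ b = 0.
  have : (a * 2 - b) ^+ 2 + 3 * b ^+ 2 = 0 by lia.
  by rewrite !expr2 => h; split; nia.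
by case=> -> ->.
Qed.

Lemma normE_ge0 x : 0 <= normE x.
Proof. by case: x => a b; rewrite /normE /= !expr2; nia. Qed.

Lemma normE_M x y : normE (x * y) = normE x * normE y.
Proof. by case: x y => [a b] [c d]; rewrite /normE /=; ring. Qed.

Lemma eis_mulf_eq0 (x y : eisenstein) : x * y = 0 -> x = 0 \/ y = 0.
Proof.
move=> /(congr1 normE); rewrite normE_M => /eqP; rewrite mulf_eq0.
by case/orP => /eqP /normE_eq0 ->; [left | right].
Qed.

Definition omega : eisenstein := (0, 1).
Definition theta : eisenstein := (1, 2).

Lemma thetaE : omega - conjE omega = theta. Proof. by []. Qed.
Lemma conj_theta : conjE theta = - theta. Proof. by []. Qed.
Lemma theta_conj : theta * conjE theta = 3. Proof. by []. Qed.
Lemma theta_neq0 : theta != 0. Proof. by []. Qed.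

Lemma eisE (x : eisenstein) : x = x.1%:~R + omega * x.2%:~R.
Proof. by rewrite !eis_intrE; case: x => a b; congr pair; rewrite /=; ring. Qed.

Lemma conjE_intr (n : int) : conjE n%:~R = n%:~R.
Proof. exact: rmorph_int. Qed.

Lemma eis_real (x : eisenstein) : conjE x = x -> x = x.1%:~R.
Proof. by rewrite eis_intrE; case: x => a b [] h1 h2; congr pair; lia. Qed.

Lemma eis_int_inj : injective (intr : int -> eisenstein).
Proof. by move=> m n; rewrite !eis_intrE => -[]. Qed.

(** * The fixed lattice of an anti-involution *)

(** In Smith form the kernel is spanned by the coordinate vectors at the zero rows of [D]; [S]
    selects them and [invmx L] carries them back. *)
Lemma int_kernel_basis m n (A : 'M[int]_(m, n)) :
  exists r (B : 'M[int]_(r, m)), (forall x : 'rV_m, x *m A = 0 <-> exists y, x = y *m B) /\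
    (forall y : 'rV_r, y *m B = 0 -> y = 0).
Proof.
have [L Lu [R Ru [d _ AE]]] := int_Smith_normal_form A.
set D := \matrix_(i, j) _ in AE.
pose I := [set i | row i D == 0].
pose S : 'M[int]_(#|I|, m) := \matrix_(k, j) (enum_val k == j)%:R.
have SST : S *m S^T = 1%:M.
  apply/matrixP => k l; rewrite !mxE (bigD1 (enum_val k)) //= big1 => [|j jk].
    by rewrite !mxE eqxx mul1r addr0 eq_sym (inj_eq enum_val_inj).
  by rewrite !mxE eq_sym (negPf jk) mul0r.
have SD : S *m D = 0.
  apply/row_matrixP => k; rewrite row0 row_mul.
  have -> : row k S = delta_mx 0 (enum_val k).
    by apply/rowP => j; rewrite !mxE eqxx eq_sym.
  by rewrite -rowE; have := enum_valP k; rewrite inE => /eqP.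
have zS (z : 'rV_m) : z *m D = 0 -> z = z *m S^T *m S.
  move=> zD0; apply/rowP => i; have [iI|iI] := boolP (i \in I).
    rewrite mxE (bigD1 (enum_rank_in iI i)) //= big1 => [|k ki].
      rewrite [S _ i]mxE enum_rankK_in // eqxx mulr1 addr0 mxE (bigD1 i) //= big1 => [|j ji].
        by rewrite !mxE enum_rankK_in // eqxx mulr1 addr0.
      by rewrite !mxE enum_rankK_in // eq_sym (negPf ji) mulr0.
    rewrite [S k i]mxE; case: eqP => [ki'|_]; last by rewrite mulr0.
    by case/eqP: ki; apply: enum_val_inj; rewrite enum_rankK_in.
  have zi : z 0 i = 0.
    have [j Dij] : exists j, D i j != 0.
      apply: NNPP => noj; case/negP: iI; rewrite inE; apply/eqP/rowP => j; rewrite !mxE.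
      by apply/eqP; apply: contraT => Dij; case: noj; exists j; rewrite mxE.
    have ij : i = j :> nat by apply/eqP; apply: contraNT Dij => /negPf ij; rewrite mxE ij mulr0n.
    have /rowP/(_ j) := zD0; rewrite [LHS]mxE (bigD1 i) //= big1 => [|k ki].
      by rewrite addr0 [RHS]mxE => /eqP; rewrite mulf_eq0 (negPf Dij) orbF => /eqP.
    rewrite [D k j]mxE (_ : (_ == _ :> nat) = false) ?mulr0n ?mulr0 // -ij.
    exact/negP/negP.
  rewrite zi mxE big1 // => k _; rewrite [S k i]mxE; case: eqP => [ki|_]; last by rewrite mulr0.
  by have := enum_valP k; rewrite ki (negPf iI).
exists #|I|, (S *m invmx L); split=> [x|y yB0].
  split=> [xA0|[y ->]]; last first.
    by rewrite AE !mulmxA mulmxKV // -(mulmxA y) SD mulmx0 mul0mx.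
  exists (x *m L *m S^T); rewrite mulmxA -zS ?mulmxK //.
  rewrite -[LHS](mulmxK Ru) (_ : _ *m R = x *m A); first by rewrite xA0 mul0mx.
  by rewrite AE !mulmxA.
have yS0 : y *m S = 0 by rewrite -[LHS](mulmxKV Lu) -(mulmxA y) yB0 mul0mx.
by rewrite -[LHS]mulmx1 -SST mulmxA yS0 mul0mx.
Qed.

Lemma additive_mx m n (f : 'rV[int]_m -> 'rV[int]_n) : zmod_morphism f ->
  exists A, forall x, f x = x *m A.
Proof.
move=> fM; pose fa : {additive _ -> _} := HB.pack f (GRing.isZmodMorphism.Build _ _ f fM).
exists (\matrix_i f (delta_mx 0 i)) => x.
rewrite -[f]/(fa : _ -> _) [x in LHS]row_sum_delta raddf_sum mulmx_sum_row.
apply: eq_bigr => i _; rewrite rowK -[x 0 i]intz !scaler_int.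
by rewrite raddfMz.
Qed.

Notation "A %:E" := (map_mx (intr : int -> eisenstein) A) (at level 2, format "A %:E").
Notation starmx A := ((map_mx conjE A)^T).

Definition signJ : 'M[eisenstein]_5 := diag_mx (\row_i if i == 0 then -1 else 1).

Definition hE (x y : 'rV[eisenstein]_5) : eisenstein := (x *m signJ *m starmx y) 0 0.

Definition toE r (A : 'M[int]_(r, 5 + 5)) : 'M[eisenstein]_(r, 5) :=
  (lsubmx A)%:E + omega *: (rsubmx A)%:E.

Definition ofE r (A : 'M[eisenstein]_(r, 5)) : 'M[int]_(r, 5 + 5) :=
  row_mx (map_mx fst A) (map_mx snd A).

Lemma ofEK r : cancel (@ofE r) (@toE r).
Proof.
move=> A; rewrite /toE /ofE row_mxKl row_mxKr; apply/matrixP => i j.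
by rewrite !mxE -eisE.
Qed.

Lemma toEK r : cancel (@toE r) (@ofE r).
Proof.
move=> A; rewrite /toE /ofE -[RHS]hsubmxK; congr row_mx; apply/matrixP => i j;
  by rewrite !mxE !eis_intrE /=; lia.
Qed.

Lemma toE_mul r s (y : 'M[int]_(s, r)) A : toE (y *m A) = y%:E *m toE A.
Proof. by rewrite /toE -mulmx_lsub -mulmx_rsub !map_mxM mulmxDr scalemxAr. Qed.

Lemma toE_zmod r : zmod_morphism (@toE r).
Proof.
move=> A B; rewrite /toE !linearB /= !map_mxB scalerBr.
by rewrite opprD addrACA.
Qed.

Lemma ofE_zmod r : zmod_morphism (@ofE r).
Proof. by move=> A B; apply: (can_inj (@toEK r)); rewrite toE_zmod !ofEK. Qed.

Lemma scalemxE_inj m n (A : 'M[eisenstein]_(m, n)) c : c != 0 -> c *: A = 0 -> A = 0.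
Proof.
move=> c0 /matrixP cA; apply/matrixP => i j; have := cA i j.
by rewrite !mxE => /eis_mulf_eq0[/eqP|//]; rewrite (negPf c0).
Qed.

Lemma eis_expf_neq0 (c : eisenstein) n : c != 0 -> c ^+ n != 0.
Proof.
move=> c0; elim: n => [|n IHn]; first by rewrite expr0 oner_neq0.
by rewrite exprS; apply/eqP => /eis_mulf_eq0[] /eqP; apply/negP.
Qed.

(* A factorization of a nonzero scalar matrix through a smaller dimension would
   make its determinant vanish. *)
Lemma scalar_factor_leq m n (A : 'M[eisenstein]_(m, n)) (B : 'M_(n, m)) c :
  c != 0 -> A *m B = c%:M -> (m <= n)%N.
Proof.
move=> c0 AB; rewrite leqNgt; apply/negP => lt_nm.
have [k mE] : exists k, m = (n + k.+1)%N by exists (m - n.+1)%N; rewrite -addSnnS subnKC.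
subst m; have E : row_mx A (0 : 'M_(_, k.+1)) *m col_mx B 0 = c%:M.
  by rewrite mul_row_col mul0mx addr0.
have := congr1 determinant E; rewrite det_mulmx det_scalar.
rewrite [\det (col_mx _ _)](expand_det_row _ (rshift n ord0)) big1 ?mulr0 => [/esym/eqP|j _].
  by rewrite (negPf (eis_expf_neq0 _ c0)).
by rewrite col_mxEd mxE mul0r.
Qed.

Lemma starmxM m n p (A : 'M[eisenstein]_(m, n)) (B : 'M_(n, p)) :
  starmx (A *m B) = starmx B *m starmx A.
Proof. by rewrite map_mxM trmx_mul. Qed.

Lemma starmxK m n (A : 'M[eisenstein]_(m, n)) : starmx (starmx A) = A.
Proof. by apply/matrixP => i j; rewrite !mxE conjEK. Qed.

Lemma starmx_scalar n c : starmx (c%:M : 'M[eisenstein]_n) = (conjE c)%:M.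
Proof. by rewrite map_scalar_mx tr_scalar_mx. Qed.

Lemma starmx_int m n (A : 'M[int]_(m, n)) : starmx A%:E = (A^T)%:E.
Proof. by apply/matrixP => i j; rewrite !mxE conjE_intr. Qed.

Lemma starJ : starmx signJ = signJ.
Proof.
rewrite /signJ map_diag_mx tr_diag_mx; congr diag_mx; apply/rowP => i; rewrite !mxE.
by case: ifP; rewrite ?rmorphN rmorph1.
Qed.

Lemma signJK : signJ *m signJ = 1%:M.
Proof.
rewrite mulmx_diag -diag_const_mx; congr diag_mx; apply/rowP => i; rewrite !mxE.
by case: ifP; rewrite ?mulrNN mul1r.
Qed.

Lemma det_signJ : \det signJ = -1.
Proof.
rewrite det_diag big_ord_recl big1 => [|i _]; first by rewrite mxE mulr1.
by rewrite mxE.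
Qed.

Lemma hEDl x y z : hE (x + y) z = hE x z + hE y z.
Proof. by rewrite /hE !mulmxDl mxE. Qed.
Lemma hEZl a x y : hE (a *: x) y = a * hE x y.
Proof. by rewrite /hE -!scalemxAl mxE. Qed.
Lemma hE_conj x y : hE y x = conjE (hE x y).
Proof.
rewrite /hE -[x in LHS]starmxK; set M := y *m _ *m _; set N := x *m _ *m _.
have -> : M = starmx N by rewrite /N /M !starmxM !starmxK starJ mulmxA.
by rewrite !mxE.
Qed.
Lemma hEDr x y z : hE x (y + z) = hE x y + hE x z.
Proof. by rewrite hE_conj hEDl rmorphD /= -!hE_conj. Qed.
Lemma hEZr a x y : hE x (a *: y) = conjE a * hE x y.
Proof. by rewrite hE_conj hEZl rmorphM /= -hE_conj. Qed.
Lemma hE_mx m n (A : 'M_(m, 5)) (B : 'M_(n, 5)) i j :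
  (A *m signJ *m starmx B) i j = hE (row i A) (row j B).
Proof. by rewrite /hE -row_mul [LHS]mxE [RHS]mxE; apply: eq_bigr => k _; rewrite !mxE. Qed.

Lemma hE_diag x : hE x x = (hE x x).1%:~R.
Proof. by apply: eis_real; rewrite -hE_conj. Qed.

Lemma norm_expand (x : 'rV[eisenstein]_5) :
  hE x x = (- normE (x 0 0) + \sum_(i < 4) normE (x 0 (lift 0 i)))%:~R.
Proof.
rewrite /hE mxE big_ord_recl.
have E i : (x *m signJ) 0 i = x 0 i * (if i == 0 then -1 else 1).
  by rewrite mul_mx_diag !mxE.
rewrite E mulrN1 !mxE mulNr normE_conj [RHS]intrD mulrNz rmorph_sum /=; congr (_ + _).
by apply: eq_bigr => i _; rewrite E mulr1 !mxE normE_conj.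
Qed.

Lemma norm_ge0 (z : 'rV[eisenstein]_5) : z 0 0 = 0 -> 0 <= (hE z z).1.
Proof.
move=> z0; rewrite norm_expand z0 eis_intrE /= add0r.
by apply: sumr_ge0 => i _; apply: normE_ge0.
Qed.

(* The vector x_0 y - y_0 x has no 0-th coordinate, hence nonnegative norm. *)
Lemma reverse_cauchy_schwarz (x y : 'rV[eisenstein]_5) :
  (hE x x).1 < 0 -> (hE x x).1 * (hE y y).1 <= normE (hE x y).
Proof.
set p := (hE x x).1; set q := (hE y y).1; set u := hE x y => p_lt0.
have pE : hE x x = p%:~R by apply: hE_diag.
have qE : hE y y = q%:~R by apply: hE_diag.
set a := x 0 0; set b := y 0 0.
have a_gt0 : 0 < normE a.
  rewrite lt_def normE_ge0 andbT; apply/eqP => /normE_eq0 a0.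
  by have := norm_ge0 a0; rewrite -/p; lia.
pose z := a *: y - b *: x.
have z0 : z 0 0 = 0 by rewrite !mxE mulrC subrr.
have := norm_ge0 z0.
have zz : hE z z = (normE a * q + normE b * p)%:~R -
    (a * conjE b * conjE u + conjE (a * conjE b * conjE u)).
  rewrite /z -scaleNr hEDl !hEDr !hEZl !hEZr (hE_conj x y) -/u pE qE !rmorphD !rmorphM /=.
  by rewrite -!normE_conj rmorphN !conjEK; ring.
(* This is the norm of the 0-th coordinate of conj(u) x - p y, a vector orthogonal to x. Its
   nonnegativity, together with p times that of h(z, z), eliminates the cross term [w]. *)
have key : normE (a * conjE u - b * p%:~R) =
    normE a * normE u - p * (a * conjE b * conjE u + conjE (a * conjE b * conjE u)).1 +
    p ^+ 2 * normE b.
  rewrite eis_intrE; move: a b u p {a_gt0 z z0 zz p_lt0 pE qE} => [a1 a2] [b1 b2] [u1 u2] p.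
  by rewrite /normE /=; ring.
set w := _ + conjE _ in zz key.
have -> : (hE z z).1 = normE a * q + normE b * p - w.1 by rewrite zz eis_intrE.
have := normE_ge0 (a * conjE u - b * p%:~R); rewrite key => h1 h2.
have h3 : normE a * (p * q) <= normE a * normE u by nia.
by rewrite -(ler_pM2l a_gt0).
Qed.

Section AntiLinear.

Variable sigma : 'rV[eisenstein]_5 -> 'rV[eisenstein]_5.
Hypothesis sigmaB : zmod_morphism sigma.
Hypothesis sigmaZ : forall a x, sigma (a *: x) = conjE a *: sigma x.
Hypothesis sigmaK : involutive sigma.
Hypothesis sigma_h : forall x y, hE (sigma x) (sigma y) = conjE (hE x y).

Let sigma0 : sigma 0 = 0.
Proof. by rewrite -[0 in LHS](subrr 0) sigmaB subrr. Qed.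

Let sigmaN x : sigma (- x) = - sigma x.
Proof. by rewrite -[- x]sub0r sigmaB sigma0 sub0r. Qed.

Let sigmaD x y : sigma (x + y) = sigma x + sigma y.
Proof. by rewrite -[y in LHS]opprK sigmaB sigmaN opprK. Qed.

(** The fixed vectors are the kernel of sigma - 1 on Z^10, through the coordinates with respect to 1
    and omega. *)
Lemma fixed_basis : exists r (B : 'M[eisenstein]_(r, 5)),
  (forall x, sigma x = x <-> exists y : 'rV[int]_r, x = y%:E *m B) /\
  (forall y : 'rV[int]_r, y%:E *m B = 0 -> y = 0).
Proof.
pose f (z : 'rV[int]_(5 + 5)) := ofE (sigma (toE z)) - z.
have fB : zmod_morphism f.
  by move=> x y; rewrite /f toE_zmod sigmaB ofE_zmod !opprD opprK addrACA.
have [A fA] := additive_mx fB; have [r [B [kerB injB]]] := int_kernel_basis A.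
exists r, (toE B); split=> [x|y]; last first.
  rewrite -toE_mul => yB; apply: injB; rewrite -[LHS](toEK) yB.
  by rewrite /ofE !map_mx0 ?row_mx0.
have -> : sigma x = x <-> f (ofE x) = 0.
  rewrite /f ofEK; split=> [->|/eqP]; first by rewrite subrr.
  by rewrite subr_eq0 => /eqP /(can_inj (@ofEK 1)).
rewrite fA kerB; split=> -[y yE]; exists y; first by rewrite -toE_mul -yE ofEK.
by rewrite yE -toE_mul toEK.
Qed.
Lemma fixed_frame : exists B C : 'M[eisenstein]_5,
  [/\ forall i, sigma (row i B) = row i B,
      forall x, sigma x = x -> exists y : 'rV[int]_5, x = y%:E *m B,
      C *m B = theta%:M & B *m C = theta%:M].
Proof.
have [r [B [fixB injB]]] := fixed_basis.
have rowB i : sigma (row i B) = row i B.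
  apply/fixB; exists (delta_mx 0 i); rewrite map_delta_mx -rowE //.
have [C CB] : exists C, C *m B = theta%:M.
  have /fin_all_exists[c cE] : forall i : 'I_5, exists c : 'rV_r, c *m B = theta *: delta_mx 0 i.
    move=> i; set v : 'rV[eisenstein]_5 := delta_mx 0 i.
    have [|a aE] := (fixB (v + sigma v)).1; first by rewrite sigmaD sigmaK addrC.
    have [|b bE] := (fixB (omega *: v + conjE omega *: sigma v)).1.
      by rewrite sigmaD !sigmaZ sigmaK conjEK addrC.
    (* The terms in sigma v cancel: omega v + conj(omega) sigma v minus conj(omega) times v + sigma
       v is theta v. *)
    exists (b%:E - conjE omega *: a%:E).
    rewrite mulmxBl -scalemxAl -aE -bE scalerDr opprD addrACA subrr addr0 -scalerBl.
    by rewrite thetaE.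
  exists (\matrix_i c i); apply/row_matrixP => i; rewrite row_mul rowK cE.
  by rewrite -[theta%:M]scalemx1 linearZ /= row1.
have EindB (y : 'rV_r) : y *m B = 0 -> y = 0.
  move=> yB; have conjB : map_mx conjE y *m B = 0.
    have := congr1 sigma yB; rewrite sigma0 => <-; rewrite !mulmx_sum_row.
    rewrite (big_morph sigma sigmaD sigma0); apply: eq_bigr => i _.
    by rewrite sigmaZ rowB mxE.
  have yE : y = (map_mx fst y)%:E + omega *: (map_mx snd y)%:E.
    by apply/matrixP => i j; rewrite !mxE -eisE.
  (* Theta times the omega-part of [y] is [y] minus its conjugate, also killed by [B], so
     independence over Z applies. *)
  have q0 : map_mx snd y = 0.
    apply: injB; apply: (scalemxE_inj theta_neq0); rewrite scalemxAl.
    rewrite (_ : theta *: _ = y - map_mx conjE y) ?mulmxBl ?yB ?conjB ?subrr //.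
    apply/matrixP => i j; rewrite !mxE; case: (y i j) => p q; rewrite eis_intrE.
    by congr pair; rewrite /=; ring.
  have p0 : map_mx fst y = 0.
    by apply: injB; rewrite -[RHS]yB {2}yE q0 map_mx0 scaler0 addr0.
  by rewrite yE q0 p0 !map_mx0 scaler0 addr0.
have BC : B *m C = theta%:M.
  apply/row_matrixP => i; apply/eqP; rewrite -subr_eq0 -linearB /=; apply/eqP/EindB.
  by rewrite -row_mul mulmxBl -mulmxA CB mul_mx_scalar mul_scalar_mx subrr row0.
have r5 : r = 5%N.
  apply/eqP; rewrite eqn_leq (scalar_factor_leq theta_neq0 BC).
  exact: (scalar_factor_leq theta_neq0 CB).
subst r; exists B, C; split=> // x /fixB //.
Qed.

Lemma gram_form : exists (B C : 'M[eisenstein]_5) (G N : 'M[int]_5),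
  [/\ [/\ forall i, sigma (row i B) = row i B, C *m B = theta%:M & B *m C = theta%:M],
      B *m signJ *m starmx B = G%:E, dual_pair G N, hyperbolic G & \det G < 0].
Proof.
have [B [C [rowB fixB CB BC]]] := fixed_frame.
pose G := map_mx fst (B *m signJ *m starmx B).
have GE : B *m signJ *m starmx B = G%:E.
  apply/matrixP => i j; rewrite [RHS]mxE [in RHS]mxE; apply: eis_real.
  by rewrite hE_mx -sigma_h !rowB.
have symG : G^T = G.
  apply/matrixP => i j; apply: eis_int_inj; rewrite [G^T i j]mxE.
  have Gkl k l : (G k l)%:~R = G%:E k l by rewrite [RHS]mxE.
  rewrite !Gkl -GE !hE_mx hE_conj -sigma_h !rowB //.
(* This is 3 times the dual frame. Its products with the rows of [B] are real and sigma conjugates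
   the form, so sigma fixes its rows; they are integral combinations of the rows of [B], whose
   coefficients yield [N]. *)
pose X := theta *: (starmx C *m signJ).
have XB : X *m signJ *m starmx B = 3%:M.
  rewrite /X -!scalemxAl -(mulmxA _ signJ signJ) signJK mulmx1 -starmxM BC starmx_scalar.
  by rewrite scale_scalar_mx theta_conj.
have rowX : forall i, sigma (row i X) = row i X.
  move=> i; apply/eqP; rewrite -subr_eq0; set z := _ - _.
  have zB : z *m signJ *m starmx B = 0.
    apply/rowP => k; rewrite [RHS]mxE hE_mx row_id /z -scaleN1r hEDl hEZl.
    rewrite mulN1r -{1}(rowB k) sigma_h -hE_mx XB.
    by rewrite !mxE; case: eqP => _; rewrite ?mulr1n ?mulr0n ?rmorph0 ?rmorph_nat subrr.
  have : z *m signJ *m (starmx B *m starmx C) = 0 by rewrite mulmxA zB mul0mx.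
  rewrite -starmxM CB starmx_scalar mul_mx_scalar => /scalemxE_inj zJ.
  by rewrite -[z]mulmx1 -signJK mulmxA zJ // mul0mx.
have /fin_all_exists[n nE] : forall i, exists y : 'rV[int]_5, row i X = y%:E *m B.
  by move=> i; apply/fixB/rowX.
have XE : X = (\matrix_i n i)%:E *m B.
  apply/row_matrixP => i; rewrite nE row_mul; congr (_ *m _).
  by rewrite -map_row rowK.
have dG : dual_pair G (\matrix_i n i)^T.
  apply: dual_pairP => //; rewrite -[in LHS]symG -trmx_mul; apply: (canLR (@trmxK _ _ _)).
  rewrite tr_scalar_mx; apply/matrixP => i j; apply: eis_int_inj.
  have := XB; rewrite XE -!mulmxA (mulmxA B) GE -map_mxM => /matrixP/(_ i j).
  by rewrite [LHS]mxE => ->; rewrite !mxE; case: eqP.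
exists B, C, G, (\matrix_i n i)^T; split=> //.
  move=> x y; have E (u v : 'rV_5) : hE (u%:E *m B) (v%:E *m B) = (qf G u v)%:~R.
    by rewrite /hE starmxM starmx_int !mulmxA -!(mulmxA u%:E) GE -!map_mxM mxE mulmxA.
  have := @reverse_cauchy_schwarz (x%:E *m B) (y%:E *m B).
  rewrite !E !eis_intrE /normE /= expr0n mulr0 addr0 subr0; exact.
have detB : \det B * - conjE (\det B) = (\det G)%:~R.
  by rewrite -[RHS]det_map_mx -GE !det_mulmx det_signJ det_tr det_map_mx /= mulrN1 mulrN mulNr.
have detE : \det G = - normE (\det B).
  by apply: eis_int_inj; rewrite -detB mulrN normE_conj rmorphN.
rewrite detE oppr_lt0 lt_def normE_ge0 andbT; apply/eqP => /normE_eq0 B0.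
by have := det_dual dG; rewrite detE B0 (_ : normE 0 = 0) // oppr0 mul0r.
Qed.

Definition sgE (b : bool) : eisenstein := (-1) ^+ b.

Lemma eigen_frame : exists (P : 'M[eisenstein]_5) (e s : 'I_5 -> bool),
  P *m signJ *m starmx P = diag_mx (\row_i sgE (e i)) /\
  forall i, sigma (row i P) = sgE (s i) *: row i P.
Proof.
have [B [C [G [N [[rowB CB BC] GE dG hG detG]]]]] := gram_form.
have [U Uu [/is_diag_mxP Ud U13]] := hyperbolic_diag13 dG hG detG.
have [M defM] : exists M, M = U *m G *m U^T by eexists.
rewrite -defM in Ud U13; pose W := U%:E *m B.
pose C' := C *m (invmx U)%:E.
have C'W : C' *m W = theta%:M.
  rewrite /W /C' mulmxA -(mulmxA C) -map_mxM mulVmx // map_mx1 mulmx1 //.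
have WE : W *m signJ *m starmx W = M%:E.
  by rewrite defM /W starmxM starmx_int !mulmxA -!(mulmxA U%:E) GE -!map_mxM mulmxA.
have rowW i : sigma (row i W) = row i W.
  rewrite /W row_mul -map_row mulmx_sum_row (big_morph sigma sigmaD sigma0).
  by apply: eq_bigr => k _; rewrite sigmaZ rowB mxE conjE_intr.
have Mdiag i j : hE (row i W) (row j W) = (M i i *+ (i == j))%:~R.
  rewrite -hE_mx WE mxE; have [->|ij] := eqVneq i j; first by rewrite mulr1n.
  by rewrite Ud ?mulr0n //; apply: contraNneq ij => /val_inj ->.
have divW i : exists (p : 'rV[eisenstein]_5) (e t s : bool),
    [/\ row i W = (if t then theta else 1) *: p, sigma p = sgE s *: p &
        (M i i)%:~R = sgE e * (if t then 3 else 1)].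
  case: (U13 i) => Mi.
    exists (row i W), (M i i == -1), false, false.
    rewrite /sgE expr0 !scale1r mulr1; split=> //.
    by case: (norm1_cases Mi) => ->.
  have [m [m1 ME]] : exists m, (m = 1 \/ m = -1) /\ M i i = 3 * m.
    have [->|->] : M i i = 3 \/ M i i = -3 by lia.
      by exists 1; split; [left|].
    by exists (-1); split; [right|].
  have rowM : row i M%:E = (3 * m)%:~R *: delta_mx 0 i.
    apply/rowP => j; rewrite !mxE eqxx -ME eq_sym /=.
    have [->|ij] := eqVneq i j; first by rewrite mulr1.
    by rewrite mulr0 Ud //; apply: contraNneq ij => /val_inj ->.
  (* The quotient by theta is read off the dual frame: conj(theta) W J = M C'^*, and M_ii = 3m =
     theta conj(theta) m, so conj(theta) cancels. *)
  pose p := m%:~R *: (row i (starmx C') *m signJ).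
  have Wp : row i W = theta *: p.
    have : row i (W *m signJ) = theta *: (m%:~R *: row i (starmx C')).
      apply/eqP; rewrite -subr_eq0; apply/eqP/(scalemxE_inj (c := conjE theta)) => //.
      rewrite scalerBr -linearZ /=.
      have -> : conjE theta *: (W *m signJ) = M%:E *m starmx C'.
        by rewrite -WE -mulmxA -starmxM C'W starmx_scalar mul_mx_scalar.
      rewrite row_mul rowM -scalemxAl -rowE !scalerA [conjE theta * theta]mulrC theta_conj.
      by rewrite rmorphM /= subrr.
    by rewrite row_mul /p => E; rewrite -[LHS]mulmx1 -signJK mulmxA E -!scalemxAl.
  exists p, (m == -1), true, true; rewrite /sgE expr1; split=> //.
    apply/eqP; rewrite scaleN1r -subr_eq0 opprK; apply/eqP/(scalemxE_inj theta_neq0).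
    by have := rowW i; rewrite Wp sigmaZ conj_theta scaleNr scalerDr => <-; rewrite subrr.
  by rewrite ME rmorphM /= mulrC; case: m1 => ->.
have /fin_all_exists[p pP] := divW.
have /fin_all_exists[e eP] := pP.
have /fin_all_exists[t tP] := eP.
have /fin_all_exists[s sP] := tP.
exists (\matrix_i p i), e, s; split=> [|i]; last by rewrite rowK; case: (sP i).
apply/matrixP => i j; rewrite hE_mx !rowK [RHS]mxE [X in X *+ _]mxE.
pose tt (b : bool) : eisenstein := if b then theta else 1.
have tt0 b : tt b != 0 by case: b.
have := Mdiag i j; have [-> _ Mi] := sP i; have [-> _ _] := sP j.
rewrite -/(tt (t i)) -/(tt (t j)) hEZl hEZr => E.
have [ij|ij] := eqVneq i j.
  rewrite -ij eqxx !mulr1n Mi in E *.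
  have : (tt (t i) * conjE (tt (t i))) * (hE (p i) (p i) - sgE (e i)) = 0.
    rewrite mulrBr -mulrA E [sgE _ * _]mulrC /tt; apply/eqP; rewrite subr_eq0; apply/eqP.
    by congr (_ * _); case: (t i).
  move/eis_mulf_eq0 => [/eis_mulf_eq0[]/eqP|/eqP]; rewrite ?(negPf (tt0 _)) //.
    by case: (t i).
  by rewrite subr_eq0 => /eqP.
rewrite (negPf ij) !mulr0n in E *.
have /eis_mulf_eq0[/eqP|/eis_mulf_eq0[/eqP|//]] := E; first by rewrite (negPf (tt0 _)).
by case: (t j).
Qed.

End AntiLinear.

(** * Ordering the eigenframe and conjugating to a standard anti-involution *)

Lemma sorting_perm n (k : 'I_n -> nat) :
  exists p : 'S_n, forall i j : 'I_n, (i <= j)%N -> (k (p i) <= k (p j))%N.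
Proof.
pose t := [tuple k i | i < n].
have /tuple_permP[p sE] : perm_eq (sort leq t) t by rewrite perm_sort.
exists p => i j le_ij.
have tE l : k (p l) = nth 0%N (sort leq t) l.
  by rewrite sE -tnth_nth !tnth_mktuple.
rewrite !tE; apply: (sorted_leq_nth leq_trans leqnn) => //.
- exact: (sort_sorted leq_total).
- by rewrite inE size_sort size_tuple.
- by rewrite inE size_sort size_tuple.
Qed.

(** [j] counts the indices where [b] fails; [b ord0] keeps it at most [n], which is why j runs over
    0, ..., 4. *)
Lemma initial_segment n (b : 'I_n.+1 -> bool) : b ord0 ->
    (forall i j : 'I_n.+1, (i <= j)%N -> b j -> b i) ->
  exists j : 'I_n.+1, forall i : 'I_n.+1, b i = (i < n.+1 - j)%N.
Proof.
move=> b0 bmono; have [/existsP[i bi]|/existsPn ball] := boolP [exists i, ~~ b i].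
  case: (@arg_minnP _ i (fun i => ~~ b i) (fun i => val i) bi) => m bm mmin.
  have m0 : (0 < m)%N.
    by rewrite lt0n; apply: contraNneq bm => m0; rewrite (_ : m = ord0) //; apply: val_inj.
  have lt_m : (n.+1 - m < n.+1)%N by rewrite ltn_subrL m0.
  exists (Ordinal lt_m) => l /=; rewrite subKn; last exact: ltnW.
  apply/idP/idP => [bl|lt_lm].
    by rewrite ltnNge; apply: contra bm => /bmono; apply.
  by apply/negPn/negP => /mmin; rewrite leqNgt lt_lm.
by exists ord0 => i; rewrite subn0 ltn_ord; apply/negPn/ball.
Qed.

(** Two orthogonal vectors of norm -1 would violate the reverse Cauchy-Schwarz inequality; with
    none, the determinant, minus a norm, would be 1. *)
Lemma one_negative (P : 'M[eisenstein]_5) (e : 'I_5 -> bool) :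
    P *m signJ *m starmx P = diag_mx (\row_i sgE (e i)) ->
  exists i0, forall i, e i = (i == i0).
Proof.
move=> PE; have hP i j : hE (row i P) (row j P) = sgE (e i) *+ (i == j).
  by rewrite -hE_mx PE !mxE; case: eqP => [->|].
have uniq_neg i j : e i -> e j -> i = j.
  move=> ei ej; apply/eqP; apply: contraT => ij.
  have := @reverse_cauchy_schwarz (row i P) (row j P).
  by rewrite !hP !eqxx ei ej (negPf ij) /sgE expr1 => /(_ isT).
have [/existsP[i0 ei0]|/existsPn noneg] := boolP [exists i, e i].
  exists i0 => i; apply/idP/eqP => [ei|-> //]; exact: uniq_neg.
have := congr1 determinant PE; rewrite !det_mulmx det_signJ det_tr det_map_mx det_diag.
rewrite big1 => [|i _]; last by rewrite mxE (negPf (noneg i)).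
rewrite /= mulrN1 mulNr normE_conj -[RHS]/(1%:~R) -mulrNz => /eis_int_inj detP.
by exfalso; move: (normE_ge0 (\det P)) detP; move: (normE _) => N; lia.
Qed.

(** The sort key puts the vector of norm -1 first, then those sharing its eigenvalue, then the rest;
    that eigenvalue is the overall sign [b]. *)
Lemma sorted_frame (P : 'M[eisenstein]_5) (e s : 'I_5 -> bool) :
    P *m signJ *m starmx P = diag_mx (\row_i sgE (e i)) ->
  exists (p : 'S_5) (b : bool) (j : 'I_5),
    row_perm p P *m signJ *m starmx (row_perm p P) = signJ /\
    forall i, s (p i) = b (+) ~~ (i < 5 - j)%N.
Proof.
move=> PE; have [i0 eE] := one_negative PE.
pose k i := if i == i0 then 0%N else if s i == s i0 then 1%N else 2%N.
have [p pmono] := sorting_perm k.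
have p0 : p ord0 = i0.
  have ki0 : k i0 = 0%N by rewrite /k eqxx.
  have [q qE] : exists q, p q = i0 by exists (invg p i0); rewrite permKV.
  have := pmono ord0 q (leq0n _); rewrite qE ki0 leqn0 /k.
  by have [|_] := eqVneq (p ord0) i0; last case: (_ == s i0).
have [||j jE] := @initial_segment 4 (fun i => s (p i) == s i0).
- by rewrite p0.
- move=> i l le_il /eqP sl; have := pmono i l le_il; rewrite /k sl eqxx.
  have [->|_] := eqVneq (p i) i0; first by rewrite eqxx.
  by case: (_ == s i0) => //; case: (p l == i0).
exists p, (s i0), j; split=> [|i]; last by rewrite -jE; case: (s (p i)) (s i0) => -[].
have rowp i : row i (row_perm p P) = row (p i) P by apply/rowP => l; rewrite !mxE.
apply/matrixP => i l; rewrite hE_mx !rowp -hE_mx PE !mxE (inj_eq perm_inj) eE.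
by rewrite -p0 (inj_eq perm_inj) /sgE; case: (i == ord0).
Qed.

Definition vecE (x : lat) : 'rV[eisenstein]_5 := \row_i (x i : eisenstein).
Definition latE (v : 'rV[eisenstein]_5) : lat := [ffun i => v 0 i].

Lemma vecEK : cancel vecE latE.
Proof. by move=> x; apply/ffunP => i; rewrite ffunE mxE. Qed.

Lemma latEK : cancel latE vecE.
Proof. by move=> v; apply/rowP => i; rewrite mxE ffunE. Qed.

Lemma vecE_add x y : vecE (ladd x y) = vecE x + vecE y.
Proof. by apply/rowP => i; rewrite !mxE ffunE. Qed.

Lemma vecE_scale a x : vecE (lscale a x) = (a : eisenstein) *: vecE x.
Proof. by apply/rowP => i; rewrite !mxE ffunE. Qed.

Lemma herm_vecE x y : herm x y = hE (vecE x) (vecE y).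
Proof.
rewrite /hE mxE.
have -> : herm x y = \sum_(i < 5) (hsign i (emul (x i) (econj (y i))) : eisenstein) by [].
apply: eq_bigr => i _; rewrite mul_mx_diag !mxE /hsign -/(conjE (y i)).
by case: ifP => _; rewrite ?mulrN1 ?mulNr ?mulr1.
Qed.

Lemma anti_involution_conj_std xi : anti_involution xi ->
  exists k, Gamma_conj xi (std_xi k).
Proof.
case=> xiD _ xiZ xiK xih.
pose sigma v := vecE (xi (latE v)).
have sigmaE x : sigma (vecE x) = vecE (xi x) by rewrite /sigma vecEK.
have sigma_add u v : sigma (u + v) = sigma u + sigma v.
  by rewrite -[u]latEK -[v]latEK -vecE_add !sigmaE xiD vecE_add.
have sigmaZ a v : sigma (a *: v) = conjE a *: sigma v.
  by rewrite -[v]latEK -vecE_scale !sigmaE xiZ vecE_scale.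
have sigmaB : zmod_morphism sigma.
  by move=> u v; rewrite sigma_add -scaleN1r sigmaZ rmorphN rmorph1 scaleN1r.
have sigmaK : involutive sigma by move=> v; rewrite -[v]latEK !sigmaE xiK.
have sigma_h u v : hE (sigma u) (sigma v) = conjE (hE u v).
  by rewrite -[u]latEK -[v]latEK !sigmaE -!herm_vecE xih.
have [P0 [e [s [P0E P0s]]]] := eigen_frame sigmaB sigmaZ sigmaK sigma_h.
have [p [b [j [PE sE]]]] := sorted_frame s P0E.
set P := row_perm p P0 in PE.
have Ps i : sigma (row i P) = sgE (s (p i)) *: row i P.
  have -> : row i P = row (p i) P0 by apply/rowP => l; rewrite !mxE.
  exact: P0s.
have [Q PQ] : exists Q, P *m Q = 1%:M.
  by exists (signJ *m starmx P *m signJ); rewrite !mulmxA PE signJK.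
have QP : Q *m P = 1%:M by apply: mulmx1C.
have QE : Q *m signJ *m starmx Q = signJ.
  by rewrite -{1}PE !mulmxA QP mul1mx -!mulmxA -starmxM QP starmx_scalar rmorph1 mulmx1.
pose g x := latE (vecE x *m Q).
have gE x : vecE (g x) = vecE x *m Q by rewrite /g latEK.
have vecI := can_inj vecEK.
exists (b, j), g; split; [split|].
- by move=> x y; apply: vecI; rewrite vecE_add !gE vecE_add mulmxDl.
- by move=> a x; apply: vecI; rewrite vecE_scale !gE vecE_scale scalemxAl.
- exists (fun x => latE (vecE x *m P)) => x; apply: vecI.
    by rewrite latEK gE -mulmxA QP mulmx1.
  by rewrite gE latEK -mulmxA PQ mulmx1.
- move=> x y; rewrite !herm_vecE !gE /hE starmxM !mulmxA.
  by rewrite -(mulmxA (vecE x) Q) -(mulmxA (vecE x)) QE.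
move=> x; apply: vecI; rewrite gE -sigmaE.
set y := vecE (g x); have xE : vecE x = y *m P by rewrite /y gE -mulmxA QP mulmx1.
have -> : sigma (vecE x) = (\row_i (conjE (y 0 i) * sgE (s (p i)))) *m P.
  rewrite xE !mulmx_sum_row (big_morph sigma sigma_add (id1 := 0)).
    by apply: eq_bigr => i _; rewrite sigmaZ Ps scalerA mxE.
  by rewrite -[0 in LHS](scale0r 0) sigmaZ rmorph0 scale0r.
rewrite -mulmxA PQ mulmx1; apply/rowP => i; rewrite [LHS]mxE [RHS]mxE sE /std_xi ffunE.
have -> : y 0 i = g x i by rewrite mxE.
rewrite -/(conjE (g x i)); set c := conjE _.
by case: (i < 5 - j)%N; case: b {sE}; rewrite /sgE /= ?expr1 ?expr0 ?mulr1 ?mulrN1 //;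
  exact/esym/(@opprK eisenstein).
Qed.

(** * Reduction modulo theta *)

Definition redE (z : eisenstein) : 'F_3 := red z.

Lemma redE_zmod : zmod_morphism redE.
Proof. by case=> [a b] [c d]; rewrite /redE /red /= -rmorphB /=; congr intmul; ring. Qed.

Lemma redE_monoid : monoid_morphism redE.
Proof.
split=> // -[a b] [c d]; rewrite /redE /red /= -rmorphM /=.
apply/eqP; rewrite -subr_eq0 -rmorphB /=.
rewrite (_ : _ - _ = 3 * (- b * d)); last by ring.
by rewrite rmorphM /= (_ : 3%:~R = 0) ?mul0r //; apply: val_inj.
Qed.
HB.instance Definition _ := GRing.isZmodMorphism.Build _ _ redE redE_zmod.
HB.instance Definition _ := GRing.isMonoidMorphism.Build _ _ redE redE_monoid.

(** Conjugation is trivial modulo theta, so antilinear maps become linear and the Hermitian form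
    becomes symmetric. *)
Lemma redE_conj z : redE (conjE z) = redE z.
Proof.
case: z => a b; apply/eqP; rewrite -subr_eq0 /redE /red /= -rmorphB /=.
rewrite (_ : _ - _ = 3 * - b); last by ring.
by rewrite rmorphM /= (_ : 3%:~R = 0) ?mul0r //; apply: val_inj.
Qed.

Notation "A %:V" := (map_mx redE A) (at level 2, format "A %:V").

Lemma redV_vecE x : redV x = (vecE x)%:V.
Proof. by apply/rowP => i; rewrite !mxE. Qed.

Lemma signJ_red : signJ%:V = qgram.
Proof.
apply/matrixP => i j; rewrite !mxE; have [->|_] := eqVneq i j; last exact: rmorph0.
by rewrite mulr1n; case: ifP; rewrite ?rmorphN rmorph1.
Qed.

Lemma starmx_red m n (A : 'M[eisenstein]_(m, n)) : (starmx A)%:V = (A%:V)^T.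
Proof. by apply/matrixP => i j; rewrite !mxE redE_conj. Qed.

Definition antilinear_by (xi : lat -> lat) (A : 'M[eisenstein]_5) :=
  forall x, vecE (xi x) = map_mx conjE (vecE x) *m A.

Lemma antilinear_red xi A x : antilinear_by xi A -> redV (xi x) = redV x *m A%:V.
Proof.
move=> xiA; rewrite !redV_vecE xiA map_mxM; congr (_ *m _).
by apply/rowP => i; rewrite !mxE; apply: redE_conj.
Qed.

Lemma liftVK : cancel liftV redV.
Proof.
move=> v; apply/rowP => i; rewrite mxE ffunE /red /= addr0.
exact: (@natr_Zp 1).
Qed.

Lemma induced_mxE xi A : antilinear_by xi A -> induced_mx xi = A%:V.
Proof.
move=> xiA; apply/row_matrixP => i; rewrite rowK /inducedV (antilinear_red _ xiA) liftVK.
by rewrite -rowE.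
Qed.

Lemma sqr_F3 (x : 'F_3) : x != 0 -> x ^+ 2 = 1.
Proof. by case: x => -[|[|[|]]] // i _; apply: val_inj. Qed.

Lemma gram_det_eq r s (B : 'M['F_3]_(r, 5)) (C : 'M_(s, 5)) :
    row_free B -> row_free C -> (B == C)%MS ->
  \det (B *m qgram *m B^T) = \det (C *m qgram *m C^T).
Proof.
move=> Bf Cf BC; have rs : r = s.
  by rewrite -(eqP Bf) -(eqP Cf); apply: eqmx_rank.
subst s; have /andP[/submxP[D BE] _] := BC.
have Du : \det D != 0.
  rewrite -unitfE -unitmxE -row_free_unit -row_leq_rank -{1}(eqP Bf) BE.
  exact: mxrankM_maxl.
have -> : B *m qgram *m B^T = D *m (C *m qgram *m C^T) *m D^T.
  by rewrite BE trmx_mul !mulmxA.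
by move: (C *m _ *m _) => K; rewrite !det_mulmx det_tr mulrAC -expr2 sqr_F3 // mul1r.
Qed.

Lemma qdet_restr_basis r (B : 'M['F_3]_(r, 5)) (W : 'M_5) : row_free B -> (B == W)%MS ->
  \rank W = r /\ qdet_restr W = \det (B *m qgram *m B^T).
Proof.
move=> Bf BW; split; first by rewrite -(eqP Bf); apply/esym/eqmx_rank.
apply: gram_det_eq; rewrite ?row_base_free //.
by apply/eqmxP; apply: eqmx_trans (eq_row_base _) _; apply: eqmx_sym; apply/eqmxP.
Qed.

(** An isometry [R] intertwining [M] and [M'] takes a basis of one kernel to a basis of the other
    with the same Gram matrix. *)
Lemma kermx_congr (M M' R : 'M['F_3]_5) : R *m qgram *m R^T = qgram -> R \in unitmx ->
    M *m R = R *m M' ->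
  \rank (kermx M) = \rank (kermx M') /\ qdet_restr (kermx M) = qdet_restr (kermx M').
Proof.
move=> Rq Ru MR; pose B := row_base (kermx M) *m R.
have Rf : row_free R by rewrite row_free_unit.
have rkB : \rank B = \rank (kermx M) by rewrite mxrankMfree // eq_row_base.
have Bf : row_free B by rewrite /row_free rkB.
have BkM : (B :=: kermx M *m R)%MS by apply: eqmxMr; apply: eq_row_base.
have BW : (B == kermx M')%MS.
  apply/eqmxP; apply: eqmx_trans BkM _; apply/eqmxP/andP; split.
    by apply/sub_kermxP; rewrite -mulmxA -MR mulmxA mulmx_ker mul0mx.
  rewrite -[X in (X <= _)%MS](mulmxKV Ru); apply: submxMr; apply/sub_kermxP.
  apply: (row_free_inj Rf); rewrite mul0mx -mulmxA MR mulmxA mulmxKV //.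
  exact: mulmx_ker.
have [rkM' qM'] := @qdet_restr_basis _ B (kermx M') Bf BW; split; first exact: esym rkM'.
apply/esym; apply: etrans qM' _.
rewrite (_ : B *m _ *m _ = row_base (kermx M) *m (R *m qgram *m R^T) *m (row_base (kermx M))^T).
  by rewrite Rq.
by rewrite /B; move: (row_base _) => C; rewrite trmx_mul !mulmxA.
Qed.

Lemma additive_antilinear xi : (forall x y, xi (ladd x y) = ladd (xi x) (xi y)) ->
    (forall a x, xi (lscale a x) = lscale (econj a) (xi x)) ->
  exists A, antilinear_by xi A.
Proof.
move=> xiD xiZ; exists (\matrix_i vecE (xi (latE (delta_mx 0 i)))) => x.
pose sigma v := vecE (xi (latE v)).
have sigmaD u v : sigma (u + v) = sigma u + sigma v.
  by rewrite -[u]latEK -[v]latEK -vecE_add /sigma !vecEK xiD vecE_add.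
have sigmaZ a v : sigma (a *: v) = conjE a *: sigma v.
  by rewrite -[v]latEK -vecE_scale /sigma !vecEK xiZ vecE_scale.
have sigma0 : sigma 0 = 0 by rewrite -[0 in LHS](scale0r 0) sigmaZ rmorph0 scale0r.
rewrite -[xi x]vecEK -[in LHS](vecEK x) latEK -/(sigma (vecE x)).
rewrite [vecE x in LHS]row_sum_delta (big_morph sigma sigmaD sigma0) mulmx_sum_row.
by apply: eq_bigr => i _; rewrite sigmaZ rowK [X in _ = X *: _]mxE.
Qed.

Lemma Gamma_mx g : in_Gamma g -> exists2 Q : 'M[eisenstein]_5,
  forall x, vecE (g x) = vecE x *m Q & Q *m signJ *m starmx Q = signJ.
Proof.
case=> gD gZ _ gh; pose f v := vecE (g (latE v)).
have fD u v : f (u + v) = f u + f v.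
  by rewrite -[u]latEK -[v]latEK -vecE_add /f !vecEK gD vecE_add.
have fZ a v : f (a *: v) = a *: f v.
  by rewrite -[v]latEK -vecE_scale /f !vecEK gZ vecE_scale.
have f0 : f 0 = 0 by rewrite -[0 in LHS](scale0r 0) fZ scale0r.
pose Q := \matrix_i f (delta_mx 0 i).
have fQ x : vecE (g x) = vecE x *m Q.
  rewrite -[in LHS](vecEK x) -/(f (vecE x)).
  rewrite [vecE x in LHS]row_sum_delta (big_morph f fD f0) mulmx_sum_row.
  by apply: eq_bigr => i _; rewrite fZ rowK.
exists Q => //; apply/matrixP => i j; rewrite hE_mx !rowK /f -herm_vecE gh herm_vecE !latEK.
by rewrite -(row1 _ i) -(row1 _ j) -hE_mx mul1mx starmx_scalar rmorph1 mulmx1.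
Qed.

Lemma induced_conj xi xi' A A' g : antilinear_by xi A -> antilinear_by xi' A' ->
    in_Gamma g -> (forall x, g (xi x) = xi' (g x)) ->
  exists R, [/\ R *m qgram *m R^T = qgram, R \in unitmx &
               induced_mx xi *m R = R *m induced_mx xi'].
Proof.
move=> xiA xiA' gG gxi; have [Q gQ QJ] := Gamma_mx gG.
have Rq : Q%:V *m qgram *m (Q%:V)^T = qgram.
  by rewrite -signJ_red -starmx_red -!map_mxM QJ.
have qq : qgram *m qgram = 1%:M.
  by rewrite -signJ_red -map_mxM signJK map_mx1.
have QK : Q%:V *m (qgram *m (Q%:V)^T *m qgram) = 1%:M by rewrite !mulmxA Rq qq.
have [Qu _] := mulmx1_unit QK.
exists Q%:V; split; [exact: Rq | exact: Qu |].
rewrite (induced_mxE xiA) (induced_mxE xiA').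
apply/row_matrixP => i; rewrite !rowE !mulmxA.
pose x := liftV (delta_mx 0 i).
have xE : redV x = delta_mx 0 i by apply: liftVK.
rewrite -xE -(antilinear_red _ xiA).
have gred y : redV (g y) = redV y *m Q%:V by rewrite !redV_vecE gQ map_mxM.
by rewrite -gred gxi (antilinear_red _ xiA') gred.
Qed.

Lemma Gamma_conj_invariants xi xi' A A' :
    antilinear_by xi A -> antilinear_by xi' A' -> Gamma_conj xi xi' ->
  [/\ \rank (fixV xi) = \rank (fixV xi'), qdet_restr (fixV xi) = qdet_restr (fixV xi'),
      \rank (negV xi) = \rank (negV xi') & qdet_restr (negV xi) = qdet_restr (negV xi')].
Proof.
move=> xiA xiA' [g [gG gxi]]; have [R [Rq Ru MR]] := induced_conj xiA xiA' gG gxi.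
have MfR : (induced_mx xi - 1%:M) *m R = R *m (induced_mx xi' - 1%:M).
  by rewrite mulmxBl mulmxBr MR mulmx1 mul1mx.
have MnR : (induced_mx xi + 1%:M) *m R = R *m (induced_mx xi' + 1%:M).
  by rewrite mulmxDl mulmxDr MR mulmx1 mul1mx.
have [rkf qf] := kermx_congr Rq Ru MfR; have [rkn qn] := kermx_congr Rq Ru MnR.
split; [exact: rkf | exact: qf | exact: rkn | exact: qn].
Qed.

(** * Invariants of the standard anti-involutions, and the classification *)

Definition std_sign (k : bool * 'I_5) (i : 'I_5) : bool := k.1 (+) ~~ (i < 5 - k.2)%N.

Lemma std_xi_antilinear k : antilinear_by (std_xi k) (diag_mx (\row_i sgE (std_sign k i))).
Proof.
move=> x; apply/rowP => i; rewrite mul_mx_diag !mxE ffunE /std_sign.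
rewrite -/(conjE (x i)); set c := conjE _; case: k => b j /=.
by case: (i < 5 - j)%N; case: b; rewrite /sgE /= ?expr1 ?expr0 ?mulr1 ?mulrN1 //;
  apply: (@opprK eisenstein).
Qed.

(** The kernel is spanned by orthogonal coordinate vectors, of which only the 0-th contributes a
    factor -1. *)
Lemma kermx_diag (d : 'I_5 -> 'F_3) (I := [set i | d i == 0]) :
  \rank (kermx (diag_mx (\row_i d i))) = #|I| /\
  qdet_restr (kermx (diag_mx (\row_i d i))) = (if ord0 \in I then -1 else 1).
Proof.
pose B : 'M['F_3]_(#|I|, 5) := \matrix_(k, j) (enum_val k == j)%:R.
have BBT : B *m B^T = 1%:M.
  apply/matrixP => k l; rewrite !mxE (bigD1 (enum_val k)) //= big1 => [|j jk].
    by rewrite !mxE eqxx mul1r addr0 eq_sym (inj_eq enum_val_inj).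
  by rewrite !mxE eq_sym (negPf jk) mul0r.
have Bf : row_free B by apply/row_freeP; exists B^T.
set W := kermx _; have BW : (B == W)%MS.
  apply/andP; split.
    apply/sub_kermxP/matrixP => k j; rewrite mul_mx_diag !mxE.
    have [<-|_] := eqVneq; last by rewrite mul0r.
    by have := enum_valP k; rewrite inE => /eqP ->; rewrite mulr0.
  apply/row_subP => l; set z := row l W.
  have zd : z *m diag_mx (\row_i d i) = 0 by rewrite -row_mul mulmx_ker row0.
  apply/submxP; exists (z *m B^T); apply/rowP => i.
  have [iI|iI] := boolP (i \in I).
    rewrite [RHS]mxE (bigD1 (enum_rank_in iI i)) //= big1 => [|k ki].
      rewrite [B _ i]mxE enum_rankK_in // eqxx mulr1 addr0 [RHS]mxE (bigD1 i) //= big1 => [|j ji].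
        by rewrite [_^T _ _]mxE [B _ _]mxE enum_rankK_in // eqxx mulr1 addr0.
      by rewrite [_^T _ _]mxE [B _ _]mxE enum_rankK_in // eq_sym (negPf ji) mulr0.
    rewrite [B k i]mxE; case: eqP => [ki'|_]; last by rewrite mulr0.
    by case/eqP: ki; apply: enum_val_inj; rewrite enum_rankK_in.
  have -> : z 0 i = 0.
    have /rowP/(_ i)/eqP := zd; rewrite mul_mx_diag [X in X == _]mxE.
    rewrite [X in _ * X == _]mxE [X in _ == X]mxE mulf_eq0.
    by rewrite inE in iI; rewrite (negPf iI) orbF => /eqP.
  rewrite [RHS]mxE big1 // => k _; rewrite [B k i]mxE; case: eqP => [ki|_]; last by rewrite mulr0.
  by have := enum_valP k; rewrite ki (negPf iI).
have [rkW qW] := qdet_restr_basis Bf BW; split; first exact: rkW.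
apply: etrans qW _.
have -> : B *m qgram *m B^T = diag_mx (\row_k (if enum_val k == ord0 then -1 else 1)).
  apply/matrixP => k l; rewrite !mxE (bigD1 (enum_val l)) //= big1 => [|j jl]; last first.
    by rewrite [_^T _ _]mxE [B _ _]mxE eq_sym (negPf jl) mulr0.
  rewrite [_^T _ _]mxE [B _ _]mxE eqxx mulr1 addr0 mxE (bigD1 (enum_val k)) //= big1 => [|j jk].
    by rewrite !mxE eqxx mul1r addr0 (inj_eq enum_val_inj) mulrb.
  by rewrite [B _ _]mxE eq_sym (negPf jk) mul0r.
rewrite det_diag; under eq_bigr do rewrite mxE.
rewrite -(big_enum_val (fun i => if i == ord0 then -1 else 1 : 'F_3)) /=.
have [I0|I0] := boolP (ord0 \in I).
  rewrite (bigD1 ord0) //= big1 ?mulr1 // => i /andP[_ /negPf ->] //.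
by rewrite big1 // => i iI; case: eqP => // i0; rewrite i0 (negPf I0) in iI.
Qed.

(** Coordinate 0 lies before position 5 - j because j < 5, so the determinant -1 belongs to the
    eigenspace of dimension 5 - j. *)
Lemma std_xi_invariants (b : bool) (j : 'I_5) :
  [/\ \rank (fixV (std_xi (b, j))) = (if b then j : nat else 5 - j)%N,
      qdet_restr (fixV (std_xi (b, j))) = (if b then 1 else -1),
      \rank (negV (std_xi (b, j))) = (if b then 5 - j else j)%N &
      qdet_restr (negV (std_xi (b, j))) = (if b then -1 else 1)].
Proof.
pose s := std_sign (b, j).
have sgE_red (c : bool) : redE (sgE c) = (-1) ^+ c by rewrite /sgE rmorphXn rmorphN rmorph1.
have iE : induced_mx (std_xi (b, j)) = diag_mx (\row_i (-1) ^+ (s i)).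
  rewrite (induced_mxE (std_xi_antilinear _)) map_diag_mx; congr diag_mx.
  by apply/rowP => i; rewrite [LHS]mxE [RHS]mxE; apply: etrans _ (sgE_red _); rewrite mxE.
have fE : fixV (std_xi (b, j)) = kermx (diag_mx (\row_i ((-1) ^+ (s i) - 1))).
  rewrite /fixV iE -diag_const_mx -raddfB; congr (kermx (diag_mx _)).
  by apply/rowP => i; rewrite !mxE.
have nE : negV (std_xi (b, j)) = kermx (diag_mx (\row_i ((-1) ^+ (s i) + 1))).
  rewrite /negV iE -diag_const_mx -raddfD; congr (kermx (diag_mx _)).
  by apply/rowP => i; rewrite !mxE.
have [fr fq] := kermx_diag (fun i => (-1) ^+ (s i) - 1).
have [nr nq] := kermx_diag (fun i => (-1) ^+ (s i) + 1).
have fI : [set i | (-1) ^+ (s i) - 1 == 0 :> 'F_3] = [set i | ~~ s i].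
  by apply/setP => i; rewrite !inE; case: (s i).
have nI : [set i | (-1) ^+ (s i) + 1 == 0 :> 'F_3] = [set i | s i].
  by apply/setP => i; rewrite !inE; case: (s i).
have j5 := ltn_ord j.
have card_lt : #|[set i : 'I_5 | (i < 5 - j)%N]| = (5 - j)%N.
  rewrite -sum1_card (eq_bigl (fun i : 'I_5 => (i < 5 - j)%N)) => [|i]; last by rewrite inE.
  by rewrite -(big_ord_widen 5 (fun=> 1%N)) ?leq_subr // sum1_card card_ord.
have card_ge : #|[set i : 'I_5 | ~~ (i < 5 - j)%N]| = j.
  have := cardsC [set i : 'I_5 | (i < 5 - j)%N].
  rewrite card_lt card_ord (_ : ~: _ = [set i : 'I_5 | ~~ (i < 5 - j)%N]); last first.
    by apply/setP => i; rewrite !inE.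
  by move: j5; clear; lia.
rewrite fE nE fI in fr fq *; rewrite nI in nr nq.
split.
- apply: etrans fr _; rewrite /s /std_sign; case: (b) => /=.
    by rewrite -[RHS]card_ge; apply: eq_card => i; rewrite !inE negbK.
  by rewrite -[RHS]card_lt; apply: eq_card => i; rewrite !inE negbK.
- by apply: etrans fq _; rewrite inE /s /std_sign /= subn_gt0 j5; case: (b).
- apply: etrans nr _; rewrite /s /std_sign; case: (b) => /=.
    by rewrite -[RHS]card_lt; apply: eq_card => i; rewrite !inE negbK.
  by rewrite -[RHS]card_ge; apply: eq_card => i; rewrite !inE.
by apply: etrans nq _; rewrite inE /s /std_sign /= subn_gt0 j5; case: (b).
Qed.

(** The determinant recovers the overall sign, after which the dimension recovers j. *)
Lemma std_xi_fix_inj k k' :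
    \rank (fixV (std_xi k)) = \rank (fixV (std_xi k')) ->
    qdet_restr (fixV (std_xi k)) = qdet_restr (fixV (std_xi k')) -> k = k'.
Proof.
case: k k' => [b j] [b' j'].
have [r1 q1 _ _] := std_xi_invariants b j; have [r2 q2 _ _] := std_xi_invariants b' j'.
move=> /(etrans (esym r1))/esym/(etrans (esym r2)) rk.
move=> /(etrans (esym q1))/esym/(etrans (esym q2)) qd.
have bb : b = b' by case: (b) (b') qd => -[].
subst b'; congr (_, _); apply: val_inj; move: rk (ltn_ord j) (ltn_ord j'); clear.
by case: b => /=; lia.
Qed.

Lemma std_xi_neg_inj k k' :
    \rank (negV (std_xi k)) = \rank (negV (std_xi k')) ->
    qdet_restr (negV (std_xi k)) = qdet_restr (negV (std_xi k')) -> k = k'.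
Proof.
case: k k' => [b j] [b' j'].
have [_ _ r1 q1] := std_xi_invariants b j; have [_ _ r2 q2] := std_xi_invariants b' j'.
move=> /(etrans (esym r1))/esym/(etrans (esym r2)) rk.
move=> /(etrans (esym q1))/esym/(etrans (esym q2)) qd.
have bb : b = b' by case: (b) (b') qd => -[].
subst b'; congr (_, _); apply: val_inj; move: rk (ltn_ord j) (ltn_ord j'); clear.
by case: b => /=; lia.
Qed.

Lemma Gamma_conj_sym xi xi' : Gamma_conj xi xi' -> Gamma_conj xi' xi.
Proof.
case=> g [[gD gZ [f gK fK] gh] gxi]; exists f; split; [split|].
- by move=> x y; apply: (can_inj gK); rewrite gD !fK.
- by move=> a x; apply: (can_inj gK); rewrite gZ !fK.
- by exists g.
- by move=> x y; rewrite -gh !fK.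
by move=> x; apply: (can_inj gK); rewrite gxi !fK.
Qed.

Lemma Gamma_conj_trans xi xi' xi'' :
  Gamma_conj xi xi' -> Gamma_conj xi' xi'' -> Gamma_conj xi xi''.
Proof.
case=> g [[gD gZ gb gh] gxi] [f [[fD fZ fb fh] fxi]]; exists (f \o g); split; [split|].
- by move=> x y /=; rewrite gD fD.
- by move=> a x /=; rewrite gZ fZ.
- exact: bij_comp.
- by move=> x y /=; rewrite fh gh.
by move=> x /=; rewrite gxi fxi.
Qed.

Lemma std_xi_conj_inj k k' : Gamma_conj (std_xi k) (std_xi k') -> k = k'.
Proof.
move=> kk'.
have [rk qd _ _] := Gamma_conj_invariants (std_xi_antilinear k) (std_xi_antilinear k') kk'.
exact: std_xi_fix_inj rk qd.
Qed.

Theorem theorem4p1 :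
  (forall xi : lat -> lat, anti_involution xi ->
     exists! k : bool * 'I_5, Gamma_conj xi (std_xi k)) /\
  (forall xi xi' : lat -> lat, anti_involution xi -> anti_involution xi' ->
     (Gamma_conj xi xi' <->
        (\rank (fixV xi) = \rank (fixV xi') /\
         qdet_restr (fixV xi) = qdet_restr (fixV xi'))) /\
     (Gamma_conj xi xi' <->
        (\rank (negV xi) = \rank (negV xi') /\
         qdet_restr (negV xi) = qdet_restr (negV xi')))).
Proof.
split=> [xi xiP|xi xi' xiP xiP'].
  have [k xik] := anti_involution_conj_std xiP; exists k; split=> [//|k' xik'].
  exact: std_xi_conj_inj (Gamma_conj_trans (Gamma_conj_sym xik) xik').
have [A xiA] : exists A, antilinear_by xi A.
  by case: xiP => xiD _ xiZ _ _; apply: additive_antilinear.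
have [A' xiA'] : exists A, antilinear_by xi' A.
  by case: xiP' => xiD _ xiZ _ _; apply: additive_antilinear.
have [k xik] := anti_involution_conj_std xiP.
have [k' xik'] := anti_involution_conj_std xiP'.
have same_class : k = k' -> Gamma_conj xi xi'.
  by move=> kk'; apply: Gamma_conj_trans xik _; apply: Gamma_conj_sym; rewrite kk'.
have [fr fq nr nq] := Gamma_conj_invariants xiA (std_xi_antilinear k) xik.
have [fr' fq' nr' nq'] := Gamma_conj_invariants xiA' (std_xi_antilinear k') xik'.
split; split=> [xixi'|[rk qd]].
- by have [rk qd _ _] := Gamma_conj_invariants xiA xiA' xixi'; split; [exact: rk | exact: qd].
- exact/same_class/(std_xi_fix_inj (etrans (esym fr) (etrans rk fr'))
    (etrans (esym fq) (etrans qd fq'))).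
- by have [_ _ rk qd] := Gamma_conj_invariants xiA xiA' xixi'; split; [exact: rk | exact: qd].
exact/same_class/(std_xi_neg_inj (etrans (esym nr) (etrans rk nr'))
    (etrans (esym nq) (etrans qd nq'))).
Qed.
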